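(* Let $$\mathcal F=\Bigl\{F:[-1,1]\to\mathbb R\ \Big|\ F(-1)=F(1)=0,\ F\text{ convex}\Bigr\}.$$ Then $$\operatorname*{arg\,max}_{F\in\mathcal F}J=-\frac13\,a(r),$$ that is, the function $r\mapsto-\frac13(1-r^2)$ is the unique maximizer of $J$ over $\mathcal F$.
   Context: Here $a:[-1,1]\to\mathbb R$, $a(r)=1-r^2$, and $$J(F)=\int_{-1}^1\left[\frac{d}{dr}\left(\frac{F(r)^2}{a(r)}\right)F'(r)+\frac12\bigl(F'(r)\bigr)^2\right]dr,$$ where derivatives are understood in the weak sense. $J$ is the (rescaled) total energy dissipation functional for the Rayleigh-Taylor instability in the Boussinesq approximation.
   Formalization: The class of competitors is restricted to convex F that are continuous on [-1,1] with weak derivative in L²(-1,1) (i.e. F in H¹); without this the claim fails, since F = -√(1-r²) is convex, vanishes at ±1 and has J(F) = +∞. *)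

(* Defs.v *)
From HB Require Import structures.
From mathcomp Require Import all_boot all_order all_algebra.
From mathcomp Require Import all_classical all_reals all_analysis.

Set Implicit Arguments.
Unset Strict Implicit.
Unset Printing Implicit Defensive.

Import Order.TTheory GRing.Theory Num.Theory.
Import numFieldNormedType.Exports.

Local Open Scope classical_set_scope.
Local Open Scope ring_scope.

(* A function on [-1, 1] is represented by a function R -> R of which only the
   values on `[-1, 1] are ever used. *)

Definition a {R : realType} (r : R) : R := 1 - r ^+ 2.

Definition Omega {R : realType} : set R := `]-1, 1[.

Definition test_function {R : realType} (phi : R -> R) : Prop :=
  [/\ forall x, derivable phi x 1,
      continuous (derive1 phi) &
      exists K : set R, [/\ compact K, K `<=` Omega &
                            forall x, ~ K x -> phi x = 0]].

Definition is_weak_derivative {R : realType} (F g : R -> R) : Prop :=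
  [/\ locally_integrable Omega F,
      locally_integrable Omega g &
      forall phi, test_function phi ->
        (\int[@lebesgue_measure R]_(x in Omega) (F x * derive1 phi x)%:E =
         - \int[@lebesgue_measure R]_(x in Omega) (g x * phi x)%:E)%E].

(* A weak derivative is unique up to a null set, so the choice of
   representative is immaterial wherever [weak_deriv] is integrated.  The
   default 0 is never reached in [J F] for F convex on [-1, 1]: both F and
   F^2 / a are then locally Lipschitz on ]-1, 1[. *)
Definition weak_deriv {R : realType} (F : R -> R) : R -> R :=
  xget (fun=> 0) [set g | is_weak_derivative F g].

(* The integrand is real-valued and J F is its extended-real Lebesgue integral,
   the difference of the integrals of the positive and negative parts.  It can
   be -oo on convex H^1 functions; when both parts have infinite integral the
   library's convention +oo - +oo = -oo applies. *)
Definition J {R : realType} (F : R -> R) : \bar R :=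
  (\int[@lebesgue_measure R]_(r in Omega)
     (weak_deriv (fun s => F s ^+ 2 / a s) r * weak_deriv F r
      + 2^-1 * weak_deriv F r ^+ 2)%:E)%E.

Definition calF {R : realType} : set (R -> R) :=
  [set F : R -> R | [/\ F (-1) = 0, F 1 = 0 &
               convex_function (`[-1, 1] : set R^o) F]].

(* H^1(-1, 1), its elements being identified with their continuous
   representatives on [-1, 1], so that F (-1) and F 1 are genuine boundary
   values.  This is the domain on which J is considered: a convex function
   vanishing at -1 and 1 may be discontinuous there or have F' not in L^2, and
   then the integral can be +oo, as for F = - sqrt (1 - r^2), where F^2 / a = 1
   and J F = 1/2 \int F'^2 = +oo. *)
Definition sobolevH1 {R : realType} : set (R -> R) :=
  [set F : R -> R | {within `[-1, 1], continuous F} /\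
           exists2 g, is_weak_derivative F g &
             (\int[@lebesgue_measure R]_(r in Omega) (g r ^+ 2)%:E < +oo)%E].

Definition argmax {R : realType} {T : Type} (D : set T) (f : T -> \bar R) :
    set T :=
  [set x | D x /\ forall y, D y -> (f y <= f x)%E].

(* Main.v *)
Require Import Defs.
From HB Require Import structures.
From mathcomp Require Import all_boot all_order all_algebra.
From mathcomp Require Import all_classical all_reals all_analysis.
From mathcomp Require Import measurable_realfun ring lra.
Import Order.TTheory GRing.Theory Num.Theory.
Import numFieldNormedType.Exports.
Local Open Scope classical_set_scope.
Local Open Scope ring_scope.

(** Put [G = (F + a/3)^2 / a = F^2/a + (2/3) F + a/9].  Almost everywhere the
    integrand of [J F] is
      [G' F' - (1/6) (F' - 2r/3)^2 + (2/27) r^2],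
    and the last term integrates to [J (- a/3)].  Since [F'] is nondecreasing,
    [G >= 0] and [G] vanishes at [-1] and [1], integrating by parts gives
    [\int G' F' = - \int G dF' <= 0].  Hence [J F + (1/6) \int (F' - 2r/3)^2]
    is at most [J (- a/3)], and equality forces [F = - a/3].
    As [G' F'] need not be integrable ([J F] may be [-oo]), the integration by
    parts is carried out for [F'] truncated to [[-n, n]] on compact
    subintervals, and Fatou's lemma compares the positive and negative parts of
    [G' F'].  [F'] is the right derivative, which exists everywhere. *)

(** * Right derivatives and Lipschitz functions *)

Section right_derivative.
Context {R : realType}.
Notation mu := (@lebesgue_measure R).
Implicit Types (F G f g phi : R -> R) (x y c d l m : R).

(** The shift by [a/3] is forced. With [(F + c a)^2 / a] in the role of [G], the rest of the
    integrand is [- (2c - 1/2) F'^2 + 2 c^2 r F']. It is stationary at [F' = 2 c r], that is at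
    [F = - c a], only if [4 c (2c - 1/2) = 2 c^2], so [c = 0] or [c = 1/3]; the second value gives a
    negative square, with coefficient [2c - 1/2 = 1/6]. The obstacle lies at the ends, where [a]
    vanishes and [F'] may be unbounded. Since [F] is in H^1 and vanishes there, Cauchy-Schwarz
    bounds [F^2] by the distance to the end times a tail of [\int F'^2], so that [F^2 / a], and with
    it [G], tends to 0. The measure [dF'] is never built: monotonicity of the weight enters only
    through its increments on short intervals. Because right derivatives of a convex function exist
    at every interior point, sum and product rules hold pointwise, and null sets matter only when
    weak derivatives are compared. *)

Definition lip_itv F c d : Prop :=
  exists2 L, 0 <= L & forall x y, c <= x <= d -> c <= y <= d ->
    `|F x - F y| <= L * `|x - y|.

(* A right derivative along the steps [1 / (n + 1)] only, which is all that
   dominated convergence needs. *)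
Definition rderiv F x l : Prop :=
  (F (x + n.+1%:R^-1) - F x) * n.+1%:R @[n --> \oo] --> l.

Lemma cvg_shift_harmonic x : x + n.+1%:R^-1 @[n --> \oo] --> x.
Proof.
rewrite -[X in _ --> X]addr0; apply: cvgD; first exact: cvg_cst.
exact: cvg_harmonic.
Qed.

Lemma near_shift_harmonic_le x d : x < d ->
  \forall n \near \oo, x < x + n.+1%:R^-1 <= d.
Proof.
move=> xd; near=> n; rewrite ltrDl invr_gt0 ltr0Sn/=.
near: n; exact: (cvgr_le _ (@cvg_shift_harmonic x)).
Unshelve. all: by end_near. Qed.

Lemma derivable_rderiv F x l : is_derive x 1 F l -> rderiv F x l.
Proof.
case=> dF Fl.
have h : h^-1 *: (F (h *: (1:R) + x) - F x) @[h --> 0^'] --> l.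
  by rewrite -Fl.
move/cvgr_dnbhsP : h => /(_ (fun n => n.+1%:R^-1)) h.
rewrite /rderiv (_ : (fun n => _) = fun n =>
    n.+1%:R^-1^-1 *: (F (n.+1%:R^-1 *: (1:R) + x) - F x)).
  by apply: h; split => //; exact: cvg_harmonic.
apply/funext => n; rewrite invrK /GRing.scale/= mulr1 mulrC.
by rewrite [x + _]addrC.
Qed.

Lemma rderiv_cvg F x l : rderiv F x l ->
  F (x + n.+1%:R^-1) @[n --> \oo] --> F x.
Proof.
move=> Fl; rewrite (_ : (fun n => F _) =
    fun n => (F (x + n.+1%:R^-1) - F x) * n.+1%:R * n.+1%:R^-1 + F x).
  rewrite -[X in _ --> X]add0r; apply: cvgD; last exact: cvg_cst.
  by rewrite -(mulr0 l); apply: cvgM => //; exact: cvg_harmonic.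
by apply/funext => n; rewrite mulfK// subrK.
Qed.

Lemma rderivD F G x l m : rderiv F x l -> rderiv G x m ->
  rderiv (F \+ G) x (l + m).
Proof.
move=> Fl Gm; rewrite /rderiv (_ : (fun n => _) = fun n =>
  (F (x + n.+1%:R^-1) - F x) * n.+1%:R +
  (G (x + n.+1%:R^-1) - G x) * n.+1%:R); first exact: cvgD.
by apply/funext => n /=; ring.
Qed.

Lemma rderivM F G x l m : rderiv F x l -> rderiv G x m ->
  rderiv (F \* G) x (l * G x + F x * m).
Proof.
move=> Fl Gm; rewrite /rderiv (_ : (fun n => _) = fun n =>
  (F (x + n.+1%:R^-1) - F x) * n.+1%:R * G (x + n.+1%:R^-1) +
  F x * ((G (x + n.+1%:R^-1) - G x) * n.+1%:R)).
  apply: cvgD; apply: cvgM => //; [exact: rderiv_cvg Gm|exact: cvg_cst].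
by apply/funext => n /=; ring.
Qed.

Lemma rderiv_near F G x d l : x < d -> (forall y, x <= y <= d -> F y = G y) ->
  rderiv F x l -> rderiv G x l.
Proof.
move=> xd FG; apply: cvg_trans; apply: near_eq_cvg; near=> n.
rewrite !FG ?lexx ?(ltW xd)//.
suff /andP[/ltW -> ->] : x < x + n.+1%:R^-1 <= d by [].
by near: n; exact: near_shift_harmonic_le.
Unshelve. all: by end_near. Qed.

Lemma lip_itvS F c d c' d' : c <= c' -> d' <= d ->
  lip_itv F c d -> lip_itv F c' d'.
Proof.
move=> cc dd [L L0 FL]; exists L => // x y xI yI.
by apply: FL; lra.
Qed.

Lemma lip_itv_bounded F c d : lip_itv F c d ->
  exists2 M, 0 <= M & forall x, c <= x <= d -> `|F x| <= M.
Proof.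
move=> [L L0 FL]; exists (`|F c| + L * `|d - c|) => [|x xcd].
  by rewrite addr_ge0 ?mulr_ge0.
rewrite -[F x](subrK (F c)) addrC (le_trans (ler_normD _ _))// lerD2l.
apply: (le_trans (FL _ _ xcd _)); first by lra.
by rewrite ler_wpM2l// !ger0_norm; lra.
Qed.

Lemma lip_itvD F G c d : lip_itv F c d -> lip_itv G c d ->
  lip_itv (F \+ G) c d.
Proof.
move=> [L L0 FL] [M M0 GM]; exists (L + M) => [|x y xI yI];
  first exact: addr_ge0.
rewrite /= opprD addrACA mulrDl (le_trans (ler_normD _ _))//.
by rewrite lerD ?FL ?GM.
Qed.

Lemma lip_itvM F G c d : lip_itv F c d -> lip_itv G c d ->
  lip_itv (F \* G) c d.
Proof.
move=> Fl Gl; have [A A0 FA] := lip_itv_bounded _ _ _ Fl.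
have [B B0 GB] := lip_itv_bounded _ _ _ Gl.
move: Fl Gl => [L L0 FL] [M M0 GM].
exists (A * M + B * L) => [|x y xI yI]; first by rewrite addr_ge0 ?mulr_ge0.
rewrite /= (_ : _ - _ = F x * (G x - G y) + G y * (F x - F y)); last by ring.
rewrite (le_trans (ler_normD _ _))// !normrM mulrDl -!mulrA.
by rewrite lerD// ler_pM ?FA ?FL ?GM ?GB.
Qed.

Lemma lip_itvV F c d e : 0 < e -> (forall x, c <= x <= d -> e <= F x) ->
  lip_itv F c d -> lip_itv (fun x => (F x)^-1) c d.
Proof.
move=> e0 Fe [L L0 FL]; exists (L / e ^+ 2) => [|x y xI yI].
  by rewrite divr_ge0// sqr_ge0.
have Fx0 := lt_le_trans e0 (Fe _ xI); have Fy0 := lt_le_trans e0 (Fe _ yI).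
rewrite (_ : _ - _ = (F x * F y)^-1 * (F y - F x)); last first.
  by field; rewrite !gt_eqF.
rewrite normrM distrC mulrAC [leRHS]mulrC ler_pM ?FL// ger0_norm.
  by rewrite lef_pV2 ?posrE ?mulr_gt0// expr2 ler_pM ?Fe ?(ltW e0).
by rewrite invr_ge0 mulr_ge0// ltW.
Qed.

Lemma lip_itv_C1 F c d : (forall x, derivable F x 1) ->
  continuous (derive1 F) -> lip_itv F c d.
Proof.
move=> dF cF; have [cd|dc] := leP c d; last first.
  by exists 0 => // x y /andP[cx xd]; have := le_trans cx xd; rewrite leNgt dc.
have [z _ zmax] : exists2 z, z \in `[c, d]%R &
    forall t, t \in `[c, d]%R -> `|derive1 F t| <= `|derive1 F z|.
  apply: EVT_max => //; apply: continuous_subspaceT => t.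
  by apply: continuous_comp; [exact: cF|exact: norm_continuous].
exists `|derive1 F z| => // x y.
wlog xy : x y / x <= y => [hw xI yI|].
  have [/hw|/ltW yx] := leP x y; first exact.
  by rewrite distrC [in leRHS]distrC; exact: hw.
move=> xI yI; rewrite distrC [in leRHS]distrC.
have [u uxy ->] : exists2 u, u \in `[x, y]%R & F y - F x = derive1 F u * (y - x).
  apply: MVT_segment => // [t _|].
    by rewrite derive1E; exact: DeriveDef.
  apply: continuous_subspaceT => t.
  exact/differentiable_continuous/derivable1_diffP.
rewrite normrM ler_wpM2r// zmax// in_itv/=.
by move: uxy; rewrite in_itv/=; lra.
Qed.

(** The nearest-point retraction onto [[c, d]]. Composing with it extends a Lipschitz function on
    the interval to the whole line with the same constant, which makes global continuity
    available. *)
Definition clamp c d x : R := Num.max c (Num.min x d).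

Lemma clamp_itv c d x : c <= d -> c <= clamp c d x <= d.
Proof. by move=> cd; rewrite /clamp le_max ge_max ge_min !lexx cd orbT. Qed.

Lemma clamp_id c d x : c <= x <= d -> clamp c d x = x.
Proof. by move=> /andP[cx xd]; rewrite /clamp (min_idPl xd) (max_idPr cx). Qed.

Lemma clamp_lip c d x y : `|clamp c d x - clamp c d y| <= `|x - y|.
Proof.
rewrite /clamp /Num.max /Num.min.
by do !case: ifPn => /=; rewrite -?leNgt => *;
  do ![case: ler0P => ?]; lra.
Qed.

Lemma lip_itv_clamp F c d : c <= d -> lip_itv F c d ->
  exists2 L, 0 <= L & forall x y,
    `|F (clamp c d x) - F (clamp c d y)| <= L * `|x - y|.
Proof.
move=> cd [L L0 FL]; exists L => // x y.
by rewrite (le_trans (FL _ _ _ _)) ?clamp_itv// ler_wpM2l ?clamp_lip.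
Qed.

Lemma lip_continuous F L : (forall x y, `|F x - F y| <= L * `|x - y|) ->
  continuous F.
Proof.
move=> FL x; apply/cvgrPdist_lt => e e0; near=> y.
apply: (le_lt_trans (FL _ _));
  apply: (@le_lt_trans _ _ ((`|L| + 1) * `|x - y|)).
  by rewrite ler_wpM2r// (le_trans (ler_norm _))// lerDl.
rewrite -ltr_pdivlMl ?ltr_wpDl// mulrC.
by near: y; apply: cvgr_dist_lt => //; rewrite divr_gt0// ltr_wpDl.
Unshelve. all: by end_near. Qed.

Lemma lip_itv_continuous F c d : c <= d -> lip_itv F c d ->
  {within `[c, d], continuous F}.
Proof.
move=> cd Fl; have [L L0 FL] := lip_itv_clamp _ _ _ cd Fl.
apply: (@subspace_eq_continuous _ _ _ (F \o clamp c d)).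
  by move=> x; rewrite /= inE/= in_itv/= => /clamp_id ->.
by apply: continuous_subspaceT => x; exact: (lip_continuous _ L).
Qed.

Lemma primitive_continuous F c : continuous F ->
  exists P : R -> R, forall x, c < x -> is_derive x 1 P (F x).
Proof.
move=> cF; exists (fun x => \int[mu]_(t in `[c, x]) F t) => x cx.
have iF : mu.-integrable `[c, x + 1] (EFin \o F).
  apply: continuous_compact_integrable; first exact: segment_compact.
  exact: continuous_subspaceT.
have xx1 : x < x + 1 by rewrite ltrDl.
have [dP P'] := @continuous_FTC1_closed R F c x (x + 1) xx1 iF cx (cF x).
by apply: DeriveDef; [exact: dP|rewrite -derive1E; exact: P'].
Qed.

Lemma integral_is_derive F f c d : c < d -> continuous f ->
  (forall x, c <= x <= d -> is_derive x 1 F (f x)) ->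
  (\int[mu]_(x in `]c, d[) (f x)%:E = (F d - F c)%:E)%E.
Proof.
move=> cd cf dF.
have cF x : c <= x <= d -> {for x, continuous F}.
  by move=> /dF[? _]; exact/differentiable_continuous/derivable1_diffP.
have mf (D : set R) : measurable_fun D (fun x => (f x)%:E).
  apply/measurable_EFinP; apply: measurable_funTS.
  exact: continuous_measurable_fun.
rewrite integral_itv_obnd_cbnd// integral_itv_bndo_bndc//.
rewrite (@continuous_FTC2 _ f F c d cd) ?EFinB//.
- exact: continuous_subspaceT.
- split => [x||].
  + by rewrite in_itv/= => xI; have [] : is_derive x 1 F (f x) by apply: dF;
      lra.
  + apply: cvg_at_right_filter; apply: cF; lra.
  + apply: cvg_at_left_filter; apply: cF; lra.
- move=> x; rewrite in_itv/= => xI.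
  have [? <-] : is_derive x 1 F (f x) by apply: dF; lra.
  by rewrite derive1E.
Qed.

Lemma continuous_measurable_itv f (D : set R) : continuous f ->
  measurable_fun D f.
Proof. by move=> cf; apply: measurable_funTS;
  exact: continuous_measurable_fun. Qed.

(* The integral of the difference quotients of [F] is computed from those of a
   primitive of [F]; dominated convergence then passes to the limit. *)
Lemma integral_rderiv F phi c d : c < d -> lip_itv F c d ->
  (forall x, c < x < d -> rderiv F x (phi x)) ->
  mu.-integrable `]c, d[ (EFin \o phi) /\
  (\int[mu]_(x in `]c, d[) (phi x)%:E = (F d - F c)%:E)%E.
Proof.
move=> cd Fl Fphi.
have [L L0 FL] := lip_itv_clamp _ _ _ (ltW cd) Fl.
set Ft := F \o clamp c d.
have cF : continuous Ft by exact: (lip_continuous _ L).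
(* The base point lies strictly left of [c], so [P] is differentiable at [c] as well. *)
have [P dP] := primitive_continuous Ft (c - 1) cF.
pose q n x := (P (x + n.+1%:R^-1) - P x) * n.+1%:R.
pose f n x := (Ft (x + n.+1%:R^-1) - Ft x) * n.+1%:R.
have n0 n : 0 < n.+1%:R^-1 :> R by rewrite invr_gt0.
have cf n : continuous (f n).
  move=> x; apply: cvgM; last exact: cvg_cst.
  apply: cvgB; last exact: cF.
  have cs : {for x, continuous (fun z : R => z + n.+1%:R^-1)}.
    by apply: cvgD; [exact: cvg_id|exact: cvg_cst].
  have := continuous_comp cs (cF _).
  exact.
have dq n x : c <= x <= d -> is_derive x 1 (q n) (f n x).
  move=> /andP[cx xd].
  have dP1 : is_derive (x + n.+1%:R^-1) 1 P (Ft (x + n.+1%:R^-1)).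
    by apply: dP; rewrite (@lt_trans _ _ x) ?ltrDl//; lra.
  have dP0 : is_derive x 1 P (Ft x) by apply: dP; lra.
  have dPs : is_derive x 1 (P \o (fun z => z + n.+1%:R^-1)) (Ft (x + n.+1%:R^-1)).
    have := @is_derive1_comp _ P (fun z => z + n.+1%:R^-1) x _ 1 dP1.
    rewrite mulr1; apply.
    have := is_deriveD (is_derive_id x (1:R)) (is_derive_cst (n.+1%:R^-1 : R) x (1:R)).
    by rewrite addr0.
  have -> : q n = n.+1%:R \*: ((P \o (fun z => z + n.+1%:R^-1)) - P).
    by apply/funext => z; rewrite /q mulrC.
  by rewrite /f mulrC; exact: is_deriveZ.
have intf n := integral_is_derive _ _ _ _ cd (cf n) (dq n).
(* [q n d] and [q n c] are difference quotients of [P], so they tend to [P' = Ft] at the two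
   ends. *)
have qcd : (q n d - q n c)%:E @[n --> \oo] --> (F d - F c)%:E.
  apply: cvg_EFin; first by apply: nearW.
  rewrite /comp/=.
  have Fd : F d = Ft d by rewrite /Ft/= clamp_id// lexx ltW.
  have Fc : F c = Ft c by rewrite /Ft/= clamp_id// lexx ltW.
  rewrite Fd Fc.
  apply: cvgB; apply: derivable_rderiv; apply: dP; lra.
have mitv : measurable (`]c, d[%classic : set (measurableTypeR R)) by [].
have mf n : measurable_fun `]c, d[ (EFin \o f n).
  by apply/measurable_EFinP; exact: continuous_measurable_itv.
have f_phi x : `]c, d[%classic x ->
  (EFin \o f n) x @[n --> \oo] --> (EFin \o phi) x.
  rewrite /= in_itv/= => /[dup] xcd /andP[cx xd].
  apply: cvg_EFin; first exact: nearW.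
  apply: (rderiv_near F _ _ d) xd _ (Fphi _ xcd) => y yI.
  by rewrite /Ft/= clamp_id//; lra.
have [] := @dominated_convergence _ _ _ mu `]c, d[ mitv (fun n => EFin \o f n)
  (EFin \o phi) (cst L%:E).
- exact: mf.
- exact: (emeasurable_fun_cvg (fun n => EFin \o f n)).
- exact/aeW.
- apply: (@measurable_bounded_integrable _ _ _ mu (cst L)) => //.
    by rewrite /= lebesgue_measure_itv/= lte_fin cd ltry.
  by exists `|L|; split => // M LM y _ /=; rewrite ltW.
(* The Lipschitz constant dominates every difference quotient. *)
- apply/aeW => x n _ /=; rewrite lee_fin normrM [X in _ * X]ger0_norm//.
  rewrite -ler_pdivlMr//; apply: (le_trans (FL _ _)).
  by rewrite addrAC subrr add0r ger0_norm// ltW.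
move=> iphi _ cvgphi; split => //.
apply: (cvg_unique _ cvgphi); first exact: ereal_hausdorff.
by rewrite (_ : [sequence _]_n = fun n => (q n d - q n c)%:E)//; exact/funext.
Qed.

End right_derivative.

(** * Test functions and weak derivatives *)

Section bump.
Context {R : realType}.
Implicit Types (f : R -> R) (x y c d l t h : R).

(** The difference quotient is within [C * |h|] of [l]. This treats polynomials and the kink of
    [sqrpos] at 0 alike. *)
Lemma is_derive_quadratic C f x l : 0 <= C ->
  (forall h, `|f (x + h) - f x - l * h| <= C * h ^+ 2) -> is_derive x 1 f l.
Proof.
move=> C0 fl.
have cl : h^-1 *: (f (h *: (1:R) + x) - f x) @[h --> 0^'] --> l.
  apply/cvgrPdist_le => e e0; near=> h.
  have h0 : h != 0 by near: h; exact: nbhs_dnbhs_neq.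
  rewrite /GRing.scale/= mulr1 [h + x]addrC distrC.
  rewrite (_ : _ - l = h^-1 * (f (x + h) - f x - l * h)); last by field.
  rewrite normrM normfV ler_pdivrMl ?normr_gt0// (le_trans (fl h))//.
  rewrite -real_normK ?num_real// expr2 mulrCA ler_wpM2l//.
  apply: (@le_trans _ _ ((C + 1) * `|h|)); first by rewrite ler_wpM2r// lerDl.
  rewrite mulrC -ler_pdivlMr ?ltr_wpDl//.
  near: h; apply: (@nbhs_dnbhs _ (0:R)); exists (e / (C + 1)).
    by rewrite /= divr_gt0// ltr_wpDl.
  by move=> z /=; rewrite sub0r normrN => /ltW.
by apply: DeriveDef; [apply/cvg_ex; exists l|exact/cvg_lim].
Unshelve. all: by end_near. Qed.

Definition sqrpos t : R := Num.max t 0 ^+ 2.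

Lemma is_derive_sqrpos t : is_derive t 1 sqrpos (2 * Num.max t 0).
Proof.
apply: (is_derive_quadratic 1) => // h; rewrite /sqrpos mul1r ler_norml.
have [t0|t0] := leP t 0; have [th0|th0] := leP (t + h) 0; apply/andP; split;
  nra.
Qed.

Lemma continuous_max0 : continuous (fun t : R => Num.max t 0).
Proof.
by move=> t; apply: (@continuous_max R R^o id (cst 0) t);
  [exact: cvg_id|exact: cvg_cst].
Qed.

Lemma is_derive1V f x l : f x != 0 -> is_derive x 1 f l ->
  is_derive x 1 (fun y => (f y)^-1) (- (f x) ^- 2 * l).
Proof.
move=> fx0 [df fl]; have := deriveV fx0 df; rewrite fl => dV.
by apply: DeriveDef; [exact: derivableV|exact: dV].
Qed.

(** With [s = sqrpos (k (x - c) (d - x))] this is [s / (1 + s)]: squaring the positive part smooths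
    its corner, and being C^1 is all that a test function requires. As [k] grows, the bump tends to
    the indicator of []c, d[]. *)
Definition smooth_bump c d (k x : R) : R :=
  1 - (1 + sqrpos (k * ((x - c) * (d - x))))^-1.

Definition dbump c d (k x : R) : R :=
  let p := k * ((x - c) * (d - x)) in
  2 * Num.max p 0 * (k * (d + c - 2 * x)) / (1 + sqrpos p) ^+ 2.

Lemma is_derive_bump c d k x : is_derive x 1 (smooth_bump c d k) (dbump c d k x).
Proof.
pose p x := k * ((x - c) * (d - x)).
have dp : is_derive x 1 p (k * (d + c - 2 * x)).
  apply: (is_derive_quadratic `|k|) => // h; rewrite /p.
  rewrite (_ : _ - _ - _ = - k * h ^+ 2); last by ring.
  by rewrite normrM normrN [X in _ * X]ger0_norm// sqr_ge0.
have dsp := @is_derive1_comp _ sqrpos p x _ _ (is_derive_sqrpos _) dp.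
have s0 : 1 + sqrpos (p x) != 0.
  by rewrite gt_eqF// ltr_wpDr// sqr_ge0.
have ds1 : is_derive x 1 (fun y => 1 + sqrpos (p y))
    (2 * Num.max (p x) 0 * (k * (d + c - 2 * x))).
  have := is_deriveD (is_derive_cst (1 : R) x (1:R)) dsp.
  by rewrite add0r.
have dsV := is_derive1V (fun y => 1 + sqrpos (p y)) _ _ s0 ds1.
have := is_deriveB (is_derive_cst (1 : R) x (1:R)) dsV.
by rewrite sub0r mulNr opprK [X in is_derive _ _ _ X]mulrC.
Qed.

Lemma continuous_dbump c d k : continuous (dbump c d k).
Proof.
pose p x := k * ((x - c) * (d - x)).
have cp : continuous p.
  move=> x; apply: cvgM; first exact: cvg_cst.
  by apply: cvgM; apply: cvgB; by [exact: cvg_id|exact: cvg_cst].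
have cm : continuous (fun x => Num.max (p x) 0).
  by move=> x; apply: (@continuous_comp _ _ _ p (fun t => Num.max t 0));
    [exact: cp|exact: continuous_max0].
have cl : continuous (fun x => k * (d + c - 2 * x)).
  move=> x; apply: cvgM; first exact: cvg_cst.
  apply: cvgB; first exact: cvg_cst.
  by apply: cvgM; [exact: cvg_cst|exact: cvg_id].
have s0 x : (1 + sqrpos (p x)) ^+ 2 != 0.
  by rewrite gt_eqF// exprn_gt0// ltr_wpDr// sqr_ge0.
have c1 : continuous (fun x => 1 + sqrpos (p x)).
  move=> x; apply: cvgD; first exact: cvg_cst.
  have : continuous ((fun x => Num.max (p x) 0) \* (fun x => Num.max (p x) 0)).
    by move=> y; apply: cvgM; exact: cm.
  exact.
have cs : continuous (fun x => (1 + sqrpos (p x)) ^+ 2).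
  have : continuous ((fun x => 1 + sqrpos (p x)) \* (fun x => 1 + sqrpos (p x))).
    by move=> y; apply: cvgM; exact: c1.
  exact.
move=> x; apply: cvgM.
  apply: cvgM; last exact: cl.
  by apply: cvgM; [exact: cvg_cst|exact: cm].
by apply: cvgV; [exact: s0|exact: cs].
Qed.

Lemma bump01 c d k x : 0 <= smooth_bump c d k x <= 1.
Proof.
rewrite /smooth_bump; have s0 : 0 <= sqrpos (k * ((x - c) * (d - x))) by exact: sqr_ge0.
by rewrite subr_ge0 invf_le1 ?ltr_wpDr// lerDl s0/= lerBlDr lerDl invr_ge0 addr_ge0.
Qed.

Lemma bump_out c d k x : 0 <= k -> c <= d -> ~ (c < x < d) ->
  smooth_bump c d k x = 0.
Proof.
move=> k0 cd xcd; rewrite /smooth_bump (_ : sqrpos _ = 0) ?addr0 ?invr1 ?subrr//.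
rewrite /sqrpos max_r ?expr0n//; rewrite mulr_ge0_le0//.
have [xc|cx] := leP x c; first by rewrite mulr_le0_ge0; lra.
have [xd|dx] := leP d x; first by rewrite mulr_ge0_le0; lra.
by case: xcd; rewrite cx dx.
Qed.

Lemma bump_test_function c d k : 0 <= k -> -1 < c -> c <= d -> d < 1 ->
  test_function (smooth_bump c d k).
Proof.
move=> k0 c1 cd d1; split.
- by move=> x; have [dx _] := is_derive_bump c d k x; exact: dx.
- rewrite (_ : derive1 _ = dbump c d k); first exact: continuous_dbump.
  by apply/funext => x; rewrite derive1E; have [] := is_derive_bump c d k x.
- exists `[c, d]%classic; split; first exact: segment_compact.
  + by move=> x; rewrite /Omega/= !in_itv/=; lra.
  + move=> x /=; rewrite in_itv/= => xcd; apply: bump_out;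
      [exact: k0|exact: cd|].
    by move=> ?; apply: xcd; lra.
Qed.

Lemma bump_cvg c d x : c < x < d ->
  smooth_bump c d n.+1%:R x @[n --> \oo] --> (1:R).
Proof.
move=> /andP[cx xd]; rewrite -[X in _ --> X]subr0.
apply: cvgB; first exact: cvg_cst.
set p := (x - c) * (d - x); have p0 : 0 < p by rewrite mulr_gt0 ?subr_gt0.
move: p p0 => p p0.
(* The defect is [1 / (1 + y^2)] with [y = n.+1%:R * p], and [y <= 1 + y^2] bounds it by [1 / y]. *)
apply: (@squeeze_cvgr _ _ _ _ (cst 0) (fun n => p^-1 * n.+1%:R^-1)).
- apply: nearW => n /=; have k0 : 0 < n.+1%:R * p by rewrite mulr_gt0.
  have -> : p^-1 * n.+1%:R^-1 = (n.+1%:R * p)^-1 by rewrite invfM mulrC.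
  have s0 : 0 <= sqrpos (n.+1%:R * p) by exact: sqr_ge0.
  have q (y : R) : y <= 1 + y ^+ 2 by nra.
  rewrite invr_ge0 addr_ge0//= lef_pV2 ?posrE//.
  + by rewrite /sqrpos max_l ?q// ltW.
  + by rewrite ltr_wpDr.
- exact: cvg_cst.
- rewrite -(mulr0 p^-1); apply: cvgM; first exact: cvg_cst.
  exact: cvg_harmonic.
Qed.

End bump.

Section weak_derivatives.
Context {R : realType}.
Notation mu := (@lebesgue_measure R).
Implicit Types (F G K f g h phi psi gam : R -> R) (x y z c d l m t : R).

(** Half-widths [1/2, 2/3, 3/4, ...] of an exhaustion of [Omega]; the shift [n.+2] keeps the first
    one positive. *)
Definition inner (n : nat) : R := 1 - n.+2%:R^-1.

Lemma inner01 n : 0 < inner n < 1.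
Proof.
have n2 : 1 < n.+2%:R :> R by rewrite ltr1n.
have n0 : 0 < n.+2%:R^-1 :> R by rewrite invr_gt0.
by rewrite /inner subr_gt0 invf_lt1// n2/= ltrBlDr ltrDl.
Qed.

Lemma inner_homo n k : (n <= k)%N -> inner n <= inner k.
Proof. by move=> nk; rewrite /inner lerD2l lerN2 lef_pV2 ?posrE// ler_nat. Qed.

Lemma cvg_inner : inner n @[n --> \oo] --> (1 : R).
Proof.
rewrite -[X in _ --> X]subr0; apply: cvgB; first exact: cvg_cst.
by rewrite (cvg_shiftS (@harmonic R)); exact: cvg_harmonic.
Qed.

Lemma near_inner x : -1 < x < 1 -> \forall n \near \oo, - inner n < x < inner n.
Proof.
move=> /andP[x1 x2]; near=> n; apply/andP; split.
  rewrite ltrNl; near: n; apply: (cvgr_gt _ cvg_inner); lra.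
near: n; exact: (cvgr_gt _ cvg_inner).
Unshelve. all: by end_near. Qed.

Lemma OmegaE : @Omega R = \bigcup_n `]- inner n, inner n[%classic.
Proof.
apply/seteqP; split => [x|x [n _]]; rewrite /Omega/= !in_itv/=.
  by move=> /near_inner[n _ /(_ n (leqnn _))]; exists n => //=; rewrite in_itv.
by have := inner01 n; lra.
Qed.

Lemma measurable_Omega : measurable (@Omega R).
Proof. exact: measurable_itv. Qed.

(** Each point of [K] lies, with a whole neighbourhood, in []- inner m, inner m[] from some rank on;
    compactness makes the rank uniform. *)
Lemma compact_Omega (K : set R) : compact K -> K `<=` Omega ->
  exists c d, [/\ -1 < c, c < d, d < 1 & K `<=` `]c, d[].
Proof.
move=> /compact_near_coveringP cK KO.
have [|N _ /(_ N (leqnn _)) KN] :=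
  cK nat \oo (fun n x => - inner n < x < inner n) _.
  move=> x /KO; rewrite /Omega/= in_itv/= => xO.
  have [c [d [cx xd c1 d1]]] : exists c d, [/\ c < x, x < d, -1 < c & d < 1].
    by exists ((x - 1) / 2), ((x + 1) / 2); split; lra.
  have [n _ cn] : \forall n \near \oo, - inner n < c < inner n.
    by apply: near_inner; lra.
  have [n' _ dn] : \forall n \near \oo, - inner n < d < inner n.
    by apply: near_inner; lra.
  exists (`]c, d[%classic, [set m | (maxn n n' <= m)%N]) => /=.
    split; first by apply: near_in_itvoo; rewrite in_itv/= cx.
    by exists (maxn n n').
  case=> y m /= []; rewrite in_itv/= geq_max => /andP[cy yd] /andP[/cn + /dn].
  by rewrite /=; lra.
exists (- inner N), (inner N); have := inner01 N => N01; split; try lra.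
by move=> x /KN; rewrite /= in_itv.
Qed.

Lemma locally_integrable_Omega f :
  (forall c d, -1 < c -> c < d -> d < 1 ->
    mu.-integrable `]c, d[ (EFin \o f)) ->
  locally_integrable Omega f.
Proof.
move=> fi; split.
- rewrite OmegaE; apply/measurable_fun_bigcup => // n.
  apply/measurable_EFinP; apply: (measurable_int mu); apply: fi;
    have := inner01 n; lra.
- exact: interval_open.
- move=> K KO cK; have [c [d [c1 cd d1 Kcd]]] := compact_Omega _ cK KO.
  have /integrableP[mf] := fi c d c1 cd d1; apply: le_lt_trans.
  apply: ge0_subset_integral => //=; first exact: compact_measurable.
  apply/measurable_EFinP; apply: measurableT_comp => //.
  exact/measurable_EFinP.
Qed.

Lemma locally_integrable_itv f c d : -1 < c -> d < 1 ->
  locally_integrable Omega f -> mu.-integrable `]c, d[ (EFin \o f).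
Proof.
move=> c1 d1 [mf _ fi]; apply/integrableP; split.
  apply/measurable_EFinP; apply: (measurable_funS measurable_Omega _ mf).
  by move=> x; rewrite /Omega/= !in_itv/=; lra.
have cO : `[c, d]%classic `<=` @Omega R.
  by move=> x; rewrite /Omega/= !in_itv/=; lra.
apply: (le_lt_trans _ (fi _ cO (@segment_compact _ c d))).
apply: ge0_subset_integral => //=.
  apply/measurable_EFinP; apply: measurableT_comp => //.
  exact: (measurable_funS measurable_Omega cO mf).
by apply: subset_itv; rewrite bnd_simp.
Qed.

Lemma integral_Omega_supp f c d : -1 <= c -> d <= 1 ->
  (forall x, ~ (c < x < d) -> f x = 0) ->
  (\int[mu]_(x in Omega) (f x)%:E = \int[mu]_(x in `]c, d[) (f x)%:E)%E.
Proof.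
move=> c1 d1 f0.
have -> : `]c, d[%classic = @Omega R `&` `]c, d[%classic.
  by apply/seteqP; split => x; rewrite /Omega/= !in_itv/=; lra.
rewrite integral_mkcondr; apply: eq_integral => x _.
rewrite patchE; case: ifPn => //; rewrite notin_setE/= in_itv/= => xcd.
by rewrite f0.
Qed.

Lemma test_function_support psi : test_function psi ->
  exists c d, [/\ -1 < c, c < d, d < 1 & forall x, ~ (c < x < d) -> psi x = 0].
Proof.
move=> [_ _ [K [cK KO psi0]]].
have [c [d [c1 cd d1 Kcd]]] := compact_Omega _ cK KO.
exists c, d; split => // x xcd; apply: psi0 => /Kcd.
by rewrite /= in_itv.
Qed.

(** * Weak derivatives of locally Lipschitz functions *)

Definition loc_lip F := forall c d, -1 < c -> d < 1 -> lip_itv F c d.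

Lemma loc_lip_integrable F c d : loc_lip F -> -1 < c -> c < d -> d < 1 ->
  mu.-integrable `]c, d[ (EFin \o F).
Proof.
move=> Fl c1 cd d1; apply: (@integrableS _ _ _ mu `[c, d]) => //.
  by apply: subset_itv; rewrite bnd_simp.
apply: continuous_compact_integrable; first exact: segment_compact.
by apply: lip_itv_continuous; [exact: ltW|exact: Fl].
Qed.

Lemma rderiv_unique F x l m : rderiv F x l -> rderiv F x m -> l = m.
Proof. exact: cvg_unique. Qed.

(** The derivative is determined by the right quotients, so it is enough that [psi] vanishes at [x]
    and just to the right of it. *)
Lemma derive1_test_function_support psi c d : (forall x, derivable psi x 1) ->
  (forall x, ~ (c < x < d) -> psi x = 0) ->
  forall x, ~ (c <= x <= d) -> derive1 psi x = 0.
Proof.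
move=> dpsi psi0 x xcd.
have rpsi : rderiv psi x (derive1 psi x).
  by apply: derivable_rderiv; rewrite derive1E; exact: DeriveDef.
have r0 : rderiv (cst 0 : R -> R) x 0 by apply: derivable_rderiv;
  exact: is_derive_cst.
apply: (rderiv_unique psi x) => //.
have [xc|cx] := ltP x c.
  by apply: (rderiv_near (cst 0) _ _ ((x + c) / 2)) => // [|y yI];
    [lra|rewrite psi0//; lra].
apply: (rderiv_near (cst 0) _ _ (x + 1)) => // [|y yI]; first lra.
by rewrite psi0//= => ycd; apply: xcd; lra.
Qed.

Lemma test_function_bounded psi : test_function psi -> forall c d,
  [bounded psi x | x in `]c, d[%classic].
Proof.
move=> [dpsi cpsi _] c d.
have [M M0 psiM] := lip_itv_bounded _ _ _ (lip_itv_C1 psi c d dpsi cpsi).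
exists M; split; first exact: num_real.
move=> N MN x /=; rewrite in_itv/= => xcd; apply: le_trans (ltW MN).
by apply: psiM; lra.
Qed.

Lemma test_function_measurable psi (D : set R) : test_function psi ->
  measurable_fun D psi.
Proof.
move=> [dpsi _ _]; apply: continuous_measurable_itv => x.
exact/differentiable_continuous/derivable1_diffP.
Qed.

Lemma integrable_test_function psi f c d : test_function psi ->
  mu.-integrable `]c, d[ (EFin \o f) ->
  mu.-integrable `]c, d[ (EFin \o (fun x => f x * psi x)).
Proof.
move=> tpsi fi.
have := integrableMl _ fi (test_function_measurable _ _ tpsi)
  (test_function_bounded _ tpsi c d).
exact.
Qed.

Lemma integral_itv_fin_num f c d : mu.-integrable `]c, d[ (EFin \o f) ->
  (\int[mu]_(x in `]c, d[) (f x)%:E)%E \is a fin_num.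
Proof. by move=> fi; apply: integrable_fin_num. Qed.

(** Apply [integral_rderiv] to [F] times the test function: the boundary values vanish, and the
    product rule splits the integrand into the two pairings of the definition. *)
Lemma rderiv_weak_derivative F phi : loc_lip F ->
  (forall x, -1 < x < 1 -> rderiv F x (phi x)) -> is_weak_derivative F phi.
Proof.
move=> Fl Fphi.
have iphi c d : -1 < c -> c < d -> d < 1 ->
  mu.-integrable `]c, d[ (EFin \o phi).
  move=> c1 cd d1; have [|//] := integral_rderiv F phi c d cd (Fl c d c1 d1).
  by move=> x xcd; apply: Fphi; lra.
split.
- by apply: locally_integrable_Omega => c d; exact: loc_lip_integrable.
- exact: locally_integrable_Omega.
move=> psi tpsi; have [c [d [c1 cd d1 psi0]]] := test_function_support _ tpsi.
have [dpsi cpsi _] := tpsi.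
(* A margin around the support: the derivative of [psi] is only known to vanish off the closed
   [[c, d]], while the integrals are cut down to an open interval. *)
set c' := (c - 1) / 2; set d' := (d + 1) / 2.
have c'1 : -1 < c' by rewrite /c'; lra.
have d'1 : d' < 1 by rewrite /d'; lra.
have cc' : c' < c by rewrite /c'; lra.
have dd' : d < d' by rewrite /d'; lra.
have cd' : c' < d' by lra.
rewrite !(integral_Omega_supp _ c' d') ?ltW//; last 2 first.
- by move=> x xcd; rewrite psi0 ?mulr0//; lra.
- move=> x xcd; rewrite (derive1_test_function_support psi c d dpsi psi0) ?mulr0; first by [].
  by move=> ?; apply: xcd; lra.
have [||ip ip0] := integral_rderiv (F \* psi)
   (fun x => phi x * psi x + F x * derive1 psi x) c' d' cd'.
- exact: (lip_itvM _ _ _ _ (Fl _ _ c'1 d'1) (lip_itv_C1 _ _ _ dpsi cpsi)).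
- move=> x xcd; apply: rderivM; first by apply: Fphi; lra.
  by apply: derivable_rderiv; rewrite derive1E; exact: DeriveDef.
have i1 := integrable_test_function _ _ _ _ tpsi (iphi c' d' c'1 cd' d'1).
have i2 : mu.-integrable `]c', d'[ (EFin \o (fun x => F x * derive1 psi x)).
  apply: eq_integrable (integrableB _ ip i1) => // x _ /=.
  by rewrite -EFinB addrAC subrr add0r.
move: ip0; rewrite /= !psi0; [|lra|lra].
rewrite !mulr0 subrr.
have -> : (\int[mu]_(x in `]c', d'[) (phi x * psi x + F x * derive1 psi x)%:E =
  \int[mu]_(x in `]c', d'[) (phi x * psi x)%:E +
  \int[mu]_(x in `]c', d'[) (F x * derive1 psi x)%:E)%E.
  exact: integralD_EFin.
rewrite -(fineK (integral_itv_fin_num _ _ _ i1)).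
rewrite -(fineK (integral_itv_fin_num _ _ _ i2)).
by rewrite -EFinD -EFinN => -[] H; congr EFin; move: H => /=; lra.
Qed.

(** * Uniqueness of weak derivatives *)

Lemma cvg_integral_bump g c d : c < d -> mu.-integrable `]c, d[ (EFin \o g) ->
  (\int[mu]_(x in `]c, d[) (g x * smooth_bump c d n.+1%:R x)%:E)%E @[n --> \oo] -->
  (\int[mu]_(x in `]c, d[) (g x)%:E)%E.
Proof.
move=> cd ig; have mg : measurable_fun `]c, d[ g.
  by apply/measurable_EFinP; exact: measurable_int ig.
have mb n : measurable_fun `]c, d[ (smooth_bump c d n.+1%:R).
  apply: continuous_measurable_itv => x; apply/differentiable_continuous.
  by apply/derivable1_diffP; have [] := is_derive_bump c d n.+1%:R x.
have mitv : measurable (`]c, d[%classic : set (measurableTypeR R)) by [].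
have [] := @dominated_convergence _ _ _ mu `]c, d[ mitv
  (fun n x => (g x * smooth_bump c d n.+1%:R x)%:E) (EFin \o g) (abse \o (EFin \o g)).
- by move=> n; apply/measurable_EFinP; exact: (measurable_funM mg (mb n)).
- exact/measurable_EFinP.
- apply/aeW => x; rewrite /= in_itv/= => xcd; apply: cvg_EFin;
    first exact: nearW.
  rewrite -[X in _ --> X]mulr1; apply: cvgM; first exact: cvg_cst.
  exact: bump_cvg.
- exact: integrable_abse.
- apply/aeW => x n _ /=; rewrite lee_fin normrM ler_piMr//.
  by have /andP[b0 b1] := bump01 c d n.+1%:R x; rewrite ger0_norm.
by move=> _ _.
Qed.

(** Paired with a bump, [g] and [h] both give minus the integral of [F] against its derivative; the
    bumps then tend to 1 on []c, d[]. *)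
Lemma weak_derivative_integral F g h c d :
  is_weak_derivative F g -> is_weak_derivative F h ->
  -1 < c -> c < d -> d < 1 ->
  (\int[mu]_(x in `]c, d[) (g x)%:E = \int[mu]_(x in `]c, d[) (h x)%:E)%E.
Proof.
move=> [_ lg Fg] [_ lh Fh] c1 cd d1.
have ig := locally_integrable_itv _ _ _ c1 d1 lg.
have ih := locally_integrable_itv _ _ _ c1 d1 lh.
have cg := cvg_integral_bump _ _ _ cd ig.
apply: (cvg_unique _ cg); first exact: ereal_hausdorff.
suff -> : (fun n : nat =>
      \int[mu]_(x in `]c, d[) (g x * smooth_bump c d n.+1%:R x)%:E)%E =
    (fun n : nat =>
      \int[mu]_(x in `]c, d[) (h x * smooth_bump c d n.+1%:R x)%:E)%E.
  exact: cvg_integral_bump.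
apply/funext => n.
have tb : test_function (smooth_bump c d n.+1%:R) by apply: bump_test_function => //; exact: ltW.
have := Fh _ tb; rewrite (Fg _ tb) => /oppe_inj.
have b0 u x : ~ c < x < d -> u x * smooth_bump c d n.+1%:R x = 0.
  by move=> xcd; rewrite bump_out ?mulr0// ltW.
by rewrite !(integral_Omega_supp _ c d (ltW c1) (ltW d1) (b0 _)).
Qed.

Lemma ae_impl (P Q : R -> Prop) : (forall x, P x -> Q x) ->
  {ae mu, forall x, P x} -> {ae mu, forall x, Q x}.
Proof. by move=> PQ; apply: filterS;
  first exact: (ae_filter_ringOfSetsType mu). Qed.

(** By Lebesgue differentiation the indefinite integral of [f] has derivative [f] almost everywhere,
    and here it is constantly zero. *)
Lemma integral_itv_ae_eq0 f c d : c < d -> mu.-integrable `]c, d[ (EFin \o f) ->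
  (forall x, c < x < d -> (\int[mu]_(t in `]c, x[) (f t)%:E = 0)%E) ->
  {ae mu, forall x, c < x < d -> f x = 0}.
Proof.
move=> cd fi f0.
have mitv : measurable (`]c, d[%classic : set (measurableTypeR R)) by [].
(* Extension by zero, so that the differentiation theorem applies to a function integrable on the
   whole line. *)
pose g := f \_ `]c, d[.
have giT : mu.-integrable setT (EFin \o g).
  rewrite /g -restrict_EFin; apply/(integrable_mkcond _ _).1 => //.
have gi y : mu.-integrable [set` Interval (BRight c) (BRight y)] (EFin \o g).
  exact: integrableS giT.
apply: ae_impl (FTC1 gi (open_integrable_locally openT giT)) => x + xcd.
set P := fun y => Rintegral _ _ _.
move=> /(_ _)[|dP gx]; first by case/andP: xcd.
have P0 y : c < y < d -> P y = 0.
  move=> ycd; rewrite /P -Rintegral_itv_bndo_bndc.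
    rewrite /Rintegral.
    have -> : (\int[mu]_(x in `]c, y[) (g x)%:E = \int[mu]_(x in `]c, y[) (f x)%:E)%E.
      apply: eq_integral => z; rewrite inE/= in_itv/= => zcy.
      by rewrite /g patchE mem_set//= in_itv/=; lra.
    by rewrite f0.
  by apply: integrableS giT.
have rP : rderiv P x (P^`()%classic x).
  by apply: derivable_rderiv; rewrite derive1E; exact: DeriveDef.
have r0 : rderiv (cst 0 : R -> R) x 0 by apply: derivable_rderiv;
  exact: is_derive_cst.
have r0P : rderiv P x 0.
  apply: (rderiv_near (cst 0) _ _ ((x + d) / 2) _ _ _ r0); first by lra.
  by move=> y yx; rewrite P0//; lra.
move: gx; rewrite (rderiv_unique _ _ _ _ rP r0P) => ->.
by rewrite /g patchE mem_set//= in_itv/=.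
Qed.

(** The equality holds almost everywhere on each interval of the exhaustion, and a countable union
    of null sets is null. *)
Lemma weak_derivative_unique F g h :
  is_weak_derivative F g -> is_weak_derivative F h ->
  {ae mu, forall x, -1 < x < 1 -> g x = h x}.
Proof.
move=> Fg Fh; have [_ lg _] := Fg; have [_ lh _] := Fh.
have gh n : {ae mu, forall x, - inner n < x < inner n -> g x = h x}.
  have /andP[n0 n1] := inner01 n.
  have n11 : -1 < - inner n by lra.
  have nn : - inner n < inner n by lra.
  have ig := locally_integrable_itv _ _ _ n11 n1 lg.
  have ih := locally_integrable_itv _ _ _ n11 n1 lh.
  have igh : mu.-integrable `]- inner n, inner n[ (EFin \o (fun x => g x - h x)).
    by apply: eq_integrable (integrableB _ ig ih).
  apply: (@ae_impl (fun x => - inner n < x < inner n -> g x - h x = 0)).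
    by move=> x ghx xn; apply/eqP; rewrite -subr_eq0 ghx.
  apply: integral_itv_ae_eq0 => //.
    move=> x /andP[nx xn].
    have ig' := locally_integrable_itv _ _ _ n11 (lt_trans xn n1) lg.
    have ih' := locally_integrable_itv _ _ _ n11 (lt_trans xn n1) lh.
    transitivity (\int[mu]_(t in `](- inner n)%R, x[) (g t)%:E -
                  \int[mu]_(t in `](- inner n)%R, x[) (h t)%:E)%E.
      exact: integralB_EFin.
    have x1 : x < 1 by exact: lt_trans n1.
    rewrite (weak_derivative_integral F g h)// subee//.
    exact: integral_itv_fin_num.
have agh : {ae mu, forall x n, - inner n < x < inner n -> g x = h x}.
  have := @ae_foralln _ _ _ mu (fun n x => - inner n < x < inner n ->
    g x = h x) gh; exact.
apply: ae_impl agh => x ghx xO.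
have [n _ /(_ n (leqnn _)) xn] := near_inner _ xO.
exact: ghx xn.
Qed.

(** * Convex functions *)

Definition slope F x y := (F y - F x) / (y - x).

(** The convexity inequality at [y], multiplied by [z - x]: comparisons of slopes become linear
    rearrangements of it. *)
Definition convex3 F := forall x y z, -1 <= x -> x < y -> y < z -> z <= 1 ->
  F y * (z - x) <= F x * (z - y) + F z * (y - x).

Lemma convex_function3 F : convex_function (`[-1, 1] : set R^o) F -> convex3 F.
Proof.
move=> cF x y z x1 xy yz z1; have xz : 0 < z - x by lra.
have t0 : 0 <= (z - y) / (z - x) by rewrite divr_ge0; lra.
have t1 : (z - y) / (z - x) <= 1 by rewrite ler_pdivrMr// mul1r; lra.
have xin : (x : R^o) \in (`[-1, 1]%classic : set R^o).
  by rewrite inE/= in_itv/=; lra.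
have zin : (z : R^o) \in (`[-1, 1]%classic : set R^o).
  by rewrite inE/= in_itv/=; lra.
set t := (z - y) / (z - x) in t0 t1.
have H : F (t * x + (1 - t) * z) <= t * F x + (1 - t) * F z.
  exact: (cF (Itv01 t0 t1) x z xin zin).
have tE : t * (z - x) = z - y by rewrite /t divfK// gt_eqF.
have t1E : (1 - t) * (z - x) = y - x by rewrite mulrBl tE; lra.
have yE : t * x + (1 - t) * z = y.
  have -> : t * x + (1 - t) * z = z - t * (z - x) by ring.
  by rewrite tE; ring.
rewrite -tE -t1E.
have := ler_wpM2r (ltW xz) H; rewrite yE; lra.
Qed.

Lemma slope_lel F x y z : convex3 F -> -1 <= x -> x < y -> y < z -> z <= 1 ->
  slope F x y <= slope F x z.
Proof.
move=> cF x1 xy yz z1; have := cF _ _ _ x1 xy yz z1.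
rewrite /slope ler_pdivrMr ?subr_gt0// mulrAC ler_pdivlMr ?subr_gt0 ?(lt_trans xy)//.
lra.
Qed.

Lemma slope_ler F x y z : convex3 F -> -1 <= x -> x < y -> y < z -> z <= 1 ->
  slope F x z <= slope F y z.
Proof.
move=> cF x1 xy yz z1; have := cF _ _ _ x1 xy yz z1.
rewrite /slope ler_pdivrMr ?subr_gt0 ?(lt_trans xy)// mulrAC ler_pdivlMr ?subr_gt0//.
lra.
Qed.

Lemma slope_le F x y z : convex3 F -> -1 <= x -> x < y -> y < z -> z <= 1 ->
  slope F x y <= slope F y z.
Proof.
by move=> cF x1 xy yz z1; apply: (le_trans (slope_lel _ _ _ _ cF x1 xy yz z1)); exact: slope_ler.
Qed.

(** Every slope within [[c, d]] lies between [slope F (-1) c] and [slope F d 1], whose denominators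
    are nonzero because [c] and [d] stay off the ends. *)
Lemma convex3_loc_lip F : convex3 F -> loc_lip F.
Proof.
move=> cF c d c1 d1; exists (`|slope F (-1) c| + `|slope F d 1|) => [|x y].
  exact: addr_ge0.
wlog xy : x y / x < y => [hw xI yI|].
  have [xy|yx|->] := ltgtP x y; first exact: hw.
    by rewrite distrC [in leRHS]distrC; exact: hw.
  by rewrite !subrr !normr0 mulr0.
move=> xI yI; rewrite distrC [in leRHS]distrC.
have -> : F y - F x = slope F x y * (y - x) by rewrite /slope divfK// subr_eq0 gt_eqF.
rewrite normrM ler_wpM2r// ler_norml; apply/andP; split.
  rewrite lerNl (@le_trans _ _ (- slope F (-1) c))//; last first.
    by rewrite (le_trans (ler_norm _))// normrN lerDl.
  rewrite lerN2 (@le_trans _ _ (slope F (-1) x))//; last first.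
    apply: slope_le => //; lra.
  have [cx|] := ltP c x; first by apply: slope_lel => //; lra.
  by move=> xc; rewrite (_ : c = x)//; lra.
rewrite (@le_trans _ _ (slope F d 1))//; last first.
  by rewrite (le_trans (ler_norm _))// lerDr.
rewrite (@le_trans _ _ (slope F y 1))//.
  apply: slope_le => //; lra.
have [yd|] := ltP y d; first by apply: slope_ler => //; lra.
by move=> dy; rewrite (_ : d = y)//; lra.
Qed.

Definition rder F x : R := limn (fun n => (F (x + n.+1%:R^-1) - F x) * n.+1%:R).

Lemma quotient_slope F x n :
  (F (x + n.+1%:R^-1) - F x) * n.+1%:R = slope F x (x + n.+1%:R^-1).
Proof. by rewrite /slope addrAC subrr add0r invrK. Qed.

(** The slopes from [x] to [x + 1/(n+1)] decrease with [n] and are bounded below by the slope from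
    [-1]. Both facts hold only from the rank where the steps stay in [[-1, 1]]. *)
Lemma convex3_rderiv F x : convex3 F -> -1 < x < 1 -> rderiv F x (rder F x).
Proof.
move=> cF /andP[x1 x2]; rewrite /rderiv /rder;
  under eq_fun do rewrite quotient_slope.
apply: (@near_nonincreasing_is_cvgn _ _ (slope F (-1) x)).
- have [N _ HN] := near_shift_harmonic_le x 1 x2.
  exists N => // k Nk m km.
  have /andP[xk k1] := HN k Nk; have /andP[xm m1] := HN m (leq_trans Nk km).
  have [<-//|mk] := eqVneq k m.
  apply: slope_lel => //; first exact: ltW.
  by rewrite ltrD2l ltf_pV2 ?posrE// ltr_nat ltnS ltn_neqAle mk.
- near=> n.
  have /andP[xn n1] : x < x + n.+1%:R^-1 <= 1.
    by near: n; exact: near_shift_harmonic_le.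
  exact: slope_le.
Unshelve. all: by end_near. Qed.

Lemma rder_slope F x y : convex3 F -> -1 < x -> x < y -> y < 1 ->
  rder F x <= slope F x y <= rder F y.
Proof.
move=> cF x1 xy y1; apply/andP; split.
- have Fx : rderiv F x (rder F x) by apply: convex3_rderiv => //; lra.
  apply: (cvgr_to_le Fx); near=> n; rewrite quotient_slope.
  have /andP[xn] : x < x + n.+1%:R^-1 <= y.
    by near: n; exact: near_shift_harmonic_le.
  rewrite le_eqVlt => /predU1P[->//|ny].
  by apply: slope_lel => //; lra.
- have Fy : rderiv F y (rder F y) by apply: convex3_rderiv => //; lra.
  apply: (cvgr_to_ge Fy); near=> n; rewrite quotient_slope.
  have /andP[yn n1] : y < y + n.+1%:R^-1 <= 1.
    by near: n; exact: near_shift_harmonic_le.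
  by apply: slope_le => //; lra.
Unshelve. all: by end_near. Qed.

Lemma rder_homo F x y : convex3 F -> -1 < x -> x <= y -> y < 1 ->
  rder F x <= rder F y.
Proof.
move=> cF x1; rewrite le_eqVlt => /predU1P[<-//|xy] y1.
by have /andP[] := rder_slope _ _ _ cF x1 xy y1; exact: le_trans.
Qed.

(** * Integration by parts against a monotone weight *)

(* Splitting an interval in its middle halves the error term, so the increment
   of [K] is nonpositive in the limit. *)
Lemma bisection_nonincreasing K phi L c d : c <= d ->
  (forall x y, c <= x -> x <= y -> y <= d ->
     K y - K x <= L * (y - x) * (phi y - phi x)) ->
  K d <= K c.
Proof.
move=> cd HK.
have Hk k x y : c <= x -> x <= y -> y <= d ->
    K y - K x <= L * (y - x) * (phi y - phi x) * 2^-1 ^+ k.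
  elim: k x y => [|k ih] x y cx xy yd; first by rewrite expr0 mulr1 HK.
  pose z := (x + y) / 2.
  have xz : x <= z by rewrite /z; lra.
  have zy : z <= y by rewrite /z; lra.
  have h1 := ih x z cx xz (le_trans zy yd).
  have h2 := ih z y (le_trans cx xz) zy yd.
  have -> : K y - K x = (K y - K z) + (K z - K x) by ring.
  apply: (le_trans (lerD h2 h1)); rewrite exprS /z.
  by rewrite le_eqVlt; apply/orP; left; apply/eqP; field.
rewrite -subr_le0.
have c0 : L * (d - c) * (phi d - phi c) * 2^-1 ^+ k @[k --> \oo] --> (0 : R).
  rewrite -(mulr0 (L * (d - c) * (phi d - phi c))); apply: cvgM;
    first exact: cvg_cst.
  by apply: cvg_expr; rewrite ger0_norm; lra.
by apply: (cvgr_to_ge c0); apply: nearW => k; exact: Hk.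
Qed.

Lemma rderiv_le F x d L l : x < d ->
  (forall y z, x <= y <= d -> x <= z <= d -> `|F y - F z| <= L * `|y - z|) ->
  rderiv F x l -> `|l| <= L.
Proof.
move=> xd FL Fl.
have cn : `|(F (x + n.+1%:R^-1) - F x) * n.+1%:R| @[n --> \oo] --> `|l|.
  exact: cvg_norm.
apply: (cvgr_to_le cn); near=> n.
have /andP[xn nd] : x < x + n.+1%:R^-1 <= d.
  by near: n; exact: near_shift_harmonic_le.
rewrite normrM [X in _ * X]ger0_norm// -ler_pdivlMr//.
apply: (le_trans (FL _ _ _ _)); first by rewrite (ltW xn).
  by rewrite lexx (le_trans (ltW xn)).
by rewrite addrAC subrr add0r ger0_norm.
Unshelve. all: by end_near. Qed.

Lemma bounded_integrable_itv f M c d : measurable_fun `]c, d[ f ->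
  (forall x, c < x < d -> `|f x| <= M) -> mu.-integrable `]c, d[ (EFin \o f).
Proof.
move=> mf fM; apply: measurable_bounded_integrable => //.
  by rewrite /= lebesgue_measure_itv/=; case: ifP => // _; rewrite -EFinB ltry.
exists M; split; first exact: num_real.
by move=> N MN x /=; rewrite in_itv/= => /fM fxM; rewrite (le_trans fxM)// ltW.
Qed.

Lemma integrable_sub_itv f c d c' d' : c <= c' -> d' <= d ->
  mu.-integrable `]c, d[ (EFin \o f) -> mu.-integrable `]c', d'[ (EFin \o f).
Proof.
move=> cc dd; apply: integrableS => //.
by move=> x; rewrite /= !in_itv/=; lra.
Qed.

Lemma Rintegral_itvoo_empty f c : \int[mu]_(x in `]c, c[) f x = 0.
Proof. by rewrite set_itv_ge ?bnd_simp ?ltxx// Rintegral_set0. Qed.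

(** Formally, [\int G' phi = [G phi] - \int G dphi] with a nonnegative last integral. In terms of
    increments: on [[x, y]], [K = \int gam phi - G phi] grows by at most [- G y (phi y - phi x) + L
    (y - x) (phi y - phi x)]. The first term is nonpositive, and [bisection_nonincreasing] removes
    the second. *)
Lemma integral_monotone_weight G gam phi c d : c < d -> lip_itv G c d ->
  (forall x, c < x < d -> rderiv G x (gam x)) ->
  (forall x, c <= x <= d -> 0 <= G x) ->
  measurable_fun `]c, d[ phi ->
  (forall x y, c <= x -> x <= y -> y <= d -> phi x <= phi y) ->
  mu.-integrable `]c, d[ (EFin \o (gam \* phi)) /\
  \int[mu]_(x in `]c, d[) (gam x * phi x) <= G d * phi d - G c * phi c.
Proof.
move=> cd Gl Gg G0 mphi phi_homo.
have [ig _] := integral_rderiv _ _ _ _ cd Gl Gg.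
have [L L0 GL] := Gl.
have gL x : c < x < d -> `|gam x| <= L.
  move=> xcd; apply: (rderiv_le G x d) (Gg _ xcd); first by lra.
  by move=> y z yx zx; apply: GL; lra.
have mg : measurable_fun `]c, d[ gam by apply/measurable_EFinP;
  exact: measurable_int ig.
have igp : mu.-integrable `]c, d[ (EFin \o (gam \* phi)).
  apply: (bounded_integrable_itv _ (L * (`|phi c| + `|phi d|))).
    exact: measurable_funM.
  move=> x xcd; rewrite normrM ler_pM// ?gL//.
  have := phi_homo c x (lexx _); have := phi_homo x d.
  move=> /(_ _ _ (lexx _)) h1 h2.
  have {}h1 : phi x <= phi d by apply: h1; lra.
  have {}h2 : phi c <= phi x by apply: h2; lra.
  rewrite ler_norml; have := ler_norm (phi d); have := ler_norm (- phi c).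
  have := normr_ge0 (phi c); have := normr_ge0 (phi d).
  rewrite normrN; lra.
split => //.
pose I x := \int[mu]_(t in `]c, x[) (gam t * phi t).
pose K x := I x - G x * phi x.
suff : K d <= K c.
  by rewrite /K /I Rintegral_itvoo_empty; lra.
apply: (bisection_nonincreasing K phi L); first exact: ltW.
move=> x y cx; rewrite le_eqVlt => /predU1P[<-|xy yd]; first by lra.
have IE : I y - I x = \int[mu]_(t in `]x, y[) (gam t * phi t).
  have [cx'|] := ltP c x; last first.
    move=> xc; have -> : x = c by lra.
    by rewrite /I Rintegral_itvoo_empty subr0.
  have icy := integrable_sub_itv _ _ _ _ _ (lexx c) yd igp.
  rewrite /I [X in _ - X]Rintegral_itv_bndo_bndc.
    by rewrite Rintegral_itvB// bnd_simp.
  by apply: integrable_sub_itv igp; lra.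
have igxy := integrable_sub_itv _ _ _ _ _ cx yd ig.
have [_ Gxy] : mu.-integrable `]x, y[ (EFin \o gam) /\
    (\int[mu]_(x in `]x, y[) (gam x)%:E = (G y - G x)%:E)%E.
  apply: integral_rderiv => //; first exact: lip_itvS Gl.
  by move=> z zxy; apply: Gg; lra.
have p0 : 0 <= phi y - phi x by rewrite subr_ge0 phi_homo// ltW.
have igx : mu.-integrable `]x, y[ (EFin \o (fun t => gam t * phi x)).
  apply: eq_integrable (integrableZl _ (phi x) igxy) => // t _ /=.
  by rewrite mulrC EFinM.
have ic : mu.-integrable `]x, y[ (EFin \o (fun _ => L * (phi y - phi x))).
  apply: (bounded_integrable_itv _ `|L * (phi y - phi x)|) => // t _.
have Gy0 : 0 <= G y by apply: G0; lra.
have GP : 0 <= G y * (phi y - phi x) by exact: mulr_ge0.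
(* Freeze the weight at [phi x]: the error [gam t * (phi t - phi x)] is at most
   [L * (phi y - phi x)]. *)
have Ile : \int[mu]_(t in `]x, y[) (gam t * phi t) <=
    (G y - G x) * phi x + L * (phi y - phi x) * (y - x).
  have -> : (G y - G x) * phi x + L * (phi y - phi x) * (y - x) =
      \int[mu]_(t in `]x, y[) (gam t * phi x + L * (phi y - phi x)).
    rewrite RintegralD// RintegralZr// Rintegral_cst//.
    rewrite /= lebesgue_measure_itv/= lte_fin xy/=; congr (_ * _ + _).
    by rewrite /Rintegral Gxy.
  apply: le_Rintegral => //.
  - exact: (integrable_sub_itv _ _ _ _ _ cx yd igp).
  - by apply: eq_integrable (integrableD _ igx ic).
  - move=> t; rewrite /= in_itv/= => /andP[xt ty].
    have ht : 0 <= phi t - phi x by rewrite subr_ge0 phi_homo//; lra.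
    have hy : phi t <= phi y by apply: phi_homo; lra.
    have : `|gam t| <= L by apply: gL; lra.
    by rewrite ler_norml => /andP[_ gtL]; nra.
move: Ile; rewrite -IE /K; clear IE; move: (I y) (I x) => u v Ile.
rewrite (_ : _ - _ = (u - v) - G y * phi y + G x * phi x); last by ring.
nra.
Qed.

(** Cauchy-Schwarz, read off from [\int (phi - m)^2 >= 0] with [m] the mean slope. *)
Lemma sqr_increment_le F phi x y : x < y -> lip_itv F x y ->
  (forall t, x < t < y -> rderiv F t (phi t)) ->
  mu.-integrable `]x, y[ (fun t => (phi t ^+ 2)%:E) ->
  (F y - F x) ^+ 2 <= (y - x) * \int[mu]_(t in `]x, y[) (phi t ^+ 2).
Proof.
move=> xy Fl Fphi i2; have [i1 int1] := integral_rderiv _ _ _ _ xy Fl Fphi.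
pose m := (F y - F x) / (y - x).
have yx0 : 0 < y - x by rewrite subr_gt0.
have mE : F y - F x = m * (y - x) by rewrite /m divfK// gt_eqF.
have im : mu.-integrable `]x, y[ (EFin \o (fun t => - (2 * m) * phi t)).
  by apply: eq_integrable (integrableZl _ (- (2 * m)) i1).
have ic : mu.-integrable `]x, y[ (EFin \o (fun _ => m ^+ 2)).
  by apply: (bounded_integrable_itv _ `|m ^+ 2|) => // t _.
have ipc : mu.-integrable `]x, y[ (EFin \o (fun t => - (2 * m) * phi t + m ^+ 2)).
  by apply: eq_integrable (integrableD _ im ic).
have : 0 <= \int[mu]_(t in `]x, y[) (phi t ^+ 2 + (- (2 * m) * phi t + m ^+ 2)).
  apply: Rintegral_ge0 => t _.
  rewrite (_ : _ + _ = (phi t - m) ^+ 2) ?sqr_ge0//; ring.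
rewrite RintegralD// RintegralD// RintegralZl// Rintegral_cst//.
rewrite [\int[mu]_(t in `]x, y[) phi t]/Rintegral int1.
rewrite /= lebesgue_measure_itv/= lte_fin xy/= mE.
move: (Rintegral _ _ _) => I; nra.
Qed.

Lemma Rintegral_subset (A B : set R) f : measurable A -> measurable B ->
  A `<=` B -> (forall x, B x -> 0 <= f x) -> mu.-integrable B (EFin \o f) ->
  \int[mu]_(t in A) f t <= \int[mu]_(t in B) f t.
Proof.
move=> mA mB AB f0 fi; apply: fine_le.
- by apply: integrable_fin_num => //; exact: integrableS fi.
- exact: integrable_fin_num.
- apply: ge0_subset_integral => //; first exact: measurable_int fi.
Qed.

(** * Boundary behaviour of [F^2 / a] *)

Section boundary_values.
Context (F phi : R -> R).
Context (Fl : loc_lip F) (Fphi : forall x, -1 < x < 1 -> rderiv F x (phi x)).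
Context (cF : {within `[-1, 1], continuous F}) (F0 : F (-1) = 0) (F1 : F 1 = 0).
Context (i2 : mu.-integrable Omega (EFin \o (fun t => phi t ^+ 2))).

Let i2_itv c d : -1 <= c -> d <= 1 ->
  mu.-integrable `]c, d[ (EFin \o (fun t => phi t ^+ 2)).
Proof. by move=> c1 d1; exact: integrable_sub_itv i2. Qed.

Lemma cvg_F_right : F (inner n) @[n --> \oo] --> (0 : R).
Proof.
have h11 : (-1 : R) < 1 by lra.
have /(continuous_within_itvP _ h11)[_ _] := cF.
rewrite F1 => /cvg_at_leftP; apply; split; last exact: cvg_inner.
by move=> n; have /andP[] := inner01 n.
Qed.

Lemma cvg_F_left : F (- inner n) @[n --> \oo] --> (0 : R).
Proof.
have h11 : (-1 : R) < 1 by lra.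
have /(continuous_within_itvP _ h11)[_] := cF.
rewrite F0 => /cvg_at_rightP + _; apply; split; last by apply: cvgN;
  exact: cvg_inner.
by move=> n /=; have /andP[_ ?] := inner01 n; lra.
Qed.

(** Cauchy-Schwarz on [[x, inner n]], where [F (inner n)] tends to [F 1 = 0]. Keeping only the tail
    of the integral makes [F^2 / a] tend to 0 at the end instead of merely staying bounded. *)
Lemma sqr_le_right x : -1 < x < 1 ->
  F x ^+ 2 <= (1 - x) * \int[mu]_(t in `]x, 1[) (phi t ^+ 2).
Proof.
move=> x11.
have c2 : (F (inner n) - F x) ^+ 2 @[n --> \oo] --> F x ^+ 2.
  have c1 : F (inner n) - F x @[n --> \oo] --> 0 - F x.
    by apply: cvgB; [exact: cvg_F_right|exact: cvg_cst].
  by have h := cvgM c1 c1; rewrite sub0r mulrNN in h; exact: h.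
apply: (cvgr_to_le c2); near=> n.
have /andP[n0 n1] := inner01 n.
have xn : x < inner n by near: n; apply: (cvgr_gt _ cvg_inner); lra.
have x1 : -1 < x by lra.
apply: (le_trans (sqr_increment_le F phi _ _ xn (Fl _ _ x1 n1) _ _)).
- by move=> t txn; apply: Fphi; lra.
- by apply: i2_itv; lra.
apply: ler_pM.
- lra.
- by apply: Rintegral_ge0 => t _; exact: sqr_ge0.
- lra.
apply: Rintegral_subset => //.
- by move=> t; rewrite /= !in_itv/=; lra.
- by move=> t _; exact: sqr_ge0.
- by apply: i2_itv; lra.
Unshelve. all: by end_near. Qed.

Lemma sqr_le_left x : -1 < x < 1 ->
  F x ^+ 2 <= (1 + x) * \int[mu]_(t in `]-1, x[) (phi t ^+ 2).
Proof.
move=> x11.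
have c2 : (F x - F (- inner n)) ^+ 2 @[n --> \oo] --> F x ^+ 2.
  have c1 : F x - F (- inner n) @[n --> \oo] --> F x - 0.
    by apply: cvgB; [exact: cvg_cst|exact: cvg_F_left].
  by have h := cvgM c1 c1; rewrite subr0 in h; exact: h.
apply: (cvgr_to_le c2); near=> n.
have /andP[n0 n1] := inner01 n.
have xn : - inner n < x by rewrite ltrNl; near: n;
  apply: (cvgr_gt _ cvg_inner); lra.
have x1 : x < 1 by lra.
have nn1 : -1 < - inner n by lra.
apply: (le_trans (sqr_increment_le F phi _ _ xn (Fl _ _ nn1 x1) _ _)).
- by move=> t txn; apply: Fphi; lra.
- by apply: i2_itv; lra.
apply: ler_pM.
- lra.
- by apply: Rintegral_ge0 => t _; exact: sqr_ge0.
- lra.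
apply: Rintegral_subset => //.
- by move=> t; rewrite /= !in_itv/=; lra.
- by move=> t _; exact: sqr_ge0.
- by apply: i2_itv; lra.
Unshelve. all: by end_near. Qed.

Let U n : set R := Omega `&` ~` `]- inner n, inner n[.

Let mU n : measurable (U n).
Proof. by apply: measurableI; [exact: measurable_Omega|exact: measurableC]. Qed.

(** The sets [U n] shrink to the empty set, and [phi ^+ 2] is an integrable bound. *)
Lemma cvg_tail : \int[mu]_(t in U n) (phi t ^+ 2) @[n --> \oo] --> (0 : R).
Proof.
have m2 : measurable_fun Omega (EFin \o (fun t => phi t ^+ 2)).
  exact: measurable_int i2.
have [] := @dominated_convergence _ _ _ mu Omega measurable_Omega
  (fun n => (EFin \o (fun t => phi t ^+ 2)) \_ (~` `]- inner n, inner n[))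
  (cst 0)%E (EFin \o (fun t => phi t ^+ 2)).
- move=> n; apply/(measurable_restrict _ _ _).1;
    [exact: measurableC|exact: measurable_Omega|].
  by apply: measurable_funS m2; [exact: measurable_Omega|exact: subIsetl].
- exact: measurable_cst.
- apply/aeW => x; rewrite /Omega/= in_itv/= => xO.
  apply: cvg_near_cst; near=> n; rewrite patchE ifF//.
  have xn : - inner n < x < inner n by near: n; exact: near_inner.
  by apply/negbTE; rewrite notin_setE => /=; apply; rewrite in_itv.
- exact: i2.
- apply/aeW => x n _; rewrite patchE; case: ifPn => _ //=.
    by rewrite ger0_norm// sqr_ge0.
  by rewrite normr0 lee_fin sqr_ge0.
move=> _ _; rewrite integral0 => H.
rewrite /Rintegral; under eq_fun do rewrite integral_mkcondr.
exact: fine_cvg.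
Unshelve. all: by end_near. Qed.

(** In [a x = (1 - x) (1 + x)] the distance to the nearer end cancels against the factor of
    [sqr_le_right] or [sqr_le_left], and the other factor is at least 1. *)
Lemma boundary_le x n : inner n <= `|x| -> `|x| < 1 ->
  F x ^+ 2 / a x <= \int[mu]_(t in U n) (phi t ^+ 2).
Proof.
move=> nx x1; have /andP[n0 n1] := inner01 n.
have x11 : -1 < x < 1 by rewrite -ltr_norml.
have ax : a x = (1 - x) * (1 + x) by rewrite /a; ring.
have ax0 : 0 < a x by rewrite ax mulr_gt0; lra.
have sq0 t : 0 <= phi t ^+ 2 by exact: sqr_ge0.
have i2U : mu.-integrable (U n) (EFin \o (fun t => phi t ^+ 2)).
  by apply: integrableS i2; [exact: measurable_Omega|exact: mU|exact: subIsetl].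
rewrite ler_pdivrMr//.
have key (p q u v : R) : 0 <= p -> 1 <= q -> 0 <= v -> u <= v ->
    p * u <= v * (p * q).
  move=> p0 q1 v0 uv; rewrite mulrCA ler_wpM2l// (le_trans uv)//.
  by rewrite ler_peMr.
have I0 : 0 <= \int[mu]_(t in U n) (phi t ^+ 2) by exact: Rintegral_ge0.
have [x0|x0] := leP 0 x.
  rewrite ger0_norm// in nx.
  apply: (le_trans (sqr_le_right _ x11)); rewrite ax.
  apply: key; [lra|lra|exact: I0|apply: Rintegral_subset => //].
  by move=> t; rewrite /U/Omega/= !in_itv/=; lra.
rewrite ltr0_norm// in nx.
apply: (le_trans (sqr_le_left _ x11)); rewrite ax [(1 - x) * _]mulrC.
apply: key; [lra|lra|exact: I0|apply: Rintegral_subset => //].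
by move=> t; rewrite /U/Omega/= !in_itv/=; lra.
Qed.

Lemma cvg_boundary (s : R) : `|s| = 1 ->
  F (s * inner n) ^+ 2 / a (s * inner n) @[n --> \oo] --> (0 : R).
Proof.
move=> s1; apply: squeeze_cvgr (cvg_cst 0) cvg_tail.
apply: nearW => n /=; have /andP[n0 n1] := inner01 n.
have sn : `|s * inner n| = inner n by rewrite normrM s1 mul1r gtr0_norm.
rewrite boundary_le ?sn// andbT divr_ge0 ?sqr_ge0//.
have : `|s * inner n| ^+ 2 < 1 by rewrite sn expr_lt1// ltW.
by rewrite real_normK ?num_real// /a; lra.
Qed.

End boundary_values.

(** * Truncation of the weight and passage to the limit *)

Lemma integral_le_of_fatou (f : nat -> R -> \bar R) (h : R ->
  \bar R) (D : set R)
    (I : \bar R) :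
  measurable D -> (forall n, measurable_fun D (f n)) ->
  (forall n x, D x -> (0 <= f n x)%E) ->
  (forall x, D x -> f n x @[n --> \oo] --> h x) ->
  (forall n, (\int[mu]_(x in D) f n x <= I + (n.+1%:R^-1)%:E)%E) ->
  (\int[mu]_(x in D) h x <= I)%E.
Proof.
move=> mD mf f0 fh fI.
have -> : (\int[mu]_(x in D) h x = \int[mu]_(x in D) limn_einf (f^~ x))%E.
  apply: eq_integral => x /set_mem Dx; have := fh x Dx => fhx.
  rewrite is_cvg_limn_einfE; last by apply/cvg_ex; exists (h x).
  by apply/esym/cvg_lim => //; exact: ereal_hausdorff.
apply: (le_trans (fatou mu mD mf f0)).
rewrite limn_einf_lim; apply/lee_addgt0Pr => e e0.
apply: lime_le; first exact: is_cvg_einfs.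
apply: nearW => n.
have [m _ Hm] := near_shift_harmonic_le 0 e e0.
(* An index beyond [n], so that its term bounds the tail infimum, and beyond [m], so that its error
   is at most [e]. *)
have /andP[_ me] := Hm (maxn m n) (leq_maxl _ _).
apply: (@le_trans _ _ (\int[mu]_(x in D) f (maxn m n) x)%E).
  by apply: ereal_inf_lbound; exists (maxn m n) => //=; exact: leq_maxr.
apply: (le_trans (fI _)); rewrite leeD2l// lee_fin.
by rewrite add0r in me.
Qed.

Definition trunc m t : R := Num.max (- m) (Num.min t m).

Lemma trunc_homo m x y : x <= y -> trunc m x <= trunc m y.
Proof.
move=> xy; rewrite /trunc ge_max le_max lexx/= le_max; apply/orP; right.
by rewrite le_min !ge_min xy lexx orbT.
Qed.

Lemma trunc_bound m t : 0 <= m -> `|trunc m t| <= m.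
Proof.
move=> m0; rewrite /trunc ler_norml le_max lexx/= ge_max ge_min lexx orbT andbT.
lra.
Qed.

Lemma trunc_id m t : `|t| <= m -> trunc m t = t.
Proof. by rewrite ler_norml /trunc => /andP[mt tm];
  rewrite (min_idPl tm) (max_idPr mt). Qed.

(** [trunc m t] is [t] times a factor in [[0, 1]], so the product with [g] keeps its sign and can
    only shrink. *)
Lemma neg_part_trunc m (g : R) t : 0 <= m ->
  Num.max (- (g * trunc m t)) 0 <= Num.max (- (g * t)) (0 : R).
Proof.
move=> m0; have [tm|mt] := leP `|t| m; first by rewrite trunc_id.
have [t0|t0] := leP 0 t.
  rewrite ger0_norm// in mt.
  have -> : trunc m t = m by rewrite /trunc min_r ?ltW// max_r//; lra.
  rewrite ge_max !le_max lexx orbT andbT.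
  have [g0|g0] := leP 0 g.
    by apply/orP; right; rewrite oppr_le0 mulr_ge0.
  by apply/orP; left; rewrite lerN2 ler_wnM2l// ltW.
rewrite ltr0_norm// in mt.
have -> : trunc m t = - m by rewrite /trunc min_l ?max_l//; lra.
rewrite ge_max !le_max lexx orbT andbT.
have [g0|g0] := leP 0 g.
  by apply/orP; left; rewrite lerN2 ler_wpM2l//; lra.
by apply/orP; right; rewrite oppr_le0 mulr_le0// ?oppr_le0// ltW.
Qed.

(** Unlike a bound on the integral itself, an inequality between the two parts still makes sense in
    a limit where both become infinite. *)
Lemma integral_funepos_le f (D : set R) (e : R) : measurable D ->
  mu.-integrable D (EFin \o f) -> \int[mu]_(x in D) f x <= e ->
  (\int[mu]_(x in D) (EFin \o f)^\+ x <= \int[mu]_(x in D) (EFin \o f)^\- x + e%:E)%E.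
Proof.
move=> mD fi; rewrite /Rintegral -lee_fin fineK; last exact: integrable_fin_num.
rewrite integralE.
have := integrable_pos_fin_num _ fi; have := integrable_neg_fin_num _ fi.
move=> /(_ mD) nf /(_ mD) pf.
by rewrite leeBlDr// addeC.
Qed.

Lemma measurable_trunc phi m (D : set R) : measurable_fun D phi ->
  measurable_fun D (fun x => trunc m (phi x)).
Proof.
move=> mphi; apply: measurable_maxr; first exact: measurable_cst.
by apply: measurable_minr => //; exact: measurable_cst.
Qed.

(* [phi] is truncated at height [n] and integrated over an interval so large
   that [n] times the boundary values of [G] is at most [1 / (n + 1)]. *)
Lemma integral_weight_pos_le_neg G gam phi : loc_lip G ->
  (forall x, -1 < x < 1 -> rderiv G x (gam x)) ->
  (forall x, -1 < x < 1 -> 0 <= G x) ->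
  G (inner n) @[n --> \oo] --> (0 : R) ->
    G (- inner n) @[n --> \oo] --> (0 : R) ->
  measurable_fun Omega gam -> measurable_fun Omega phi ->
  (forall x y, -1 < x -> x <= y -> y < 1 -> phi x <= phi y) ->
  (\int[mu]_(x in Omega) (EFin \o (gam \* phi)%R)^\+ x <=
   \int[mu]_(x in Omega) (EFin \o (gam \* phi)%R)^\- x)%E.
Proof.
move=> Gl Gg G0 Gr Gr' mgam mphi phi_homo.
(* The interval is chosen after the height [n], as the convergence of [G] at the ends comes without
   a rate; [n <= k] ensures that the intervals still exhaust [Omega]. *)
have small n : exists k, (n <= k)%N /\
    n%:R * (G (inner k) + G (- inner k)) <= n.+1%:R^-1.
  have c0 : n%:R * (G (inner k) + G (- inner k)) @[k --> \oo] --> (0 : R).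
    rewrite -(mulr0 n%:R); apply: cvgM; first exact: cvg_cst.
    by rewrite -(addr0 0); exact: cvgD.
  have n1 : 0 < n.+1%:R^-1 :> R by rewrite invr_gt0.
  have [k _ Hk] := cvgr_le _ c0 _ n1.
  exists (maxn n k); split; first exact: leq_maxl.
  exact: (Hk _ (leq_maxr n k)).
have /all_sig[k Hk] n := cid (small n).
pose phin (n : nat) x := trunc n%:R (phi x).
pose I n : set R := `]- inner (k n), inner (k n)[%classic.
have Itv n : -1 < - inner (k n) /\ - inner (k n) < inner (k n) /\ inner (k n) < 1.
  by have := inner01 (k n); lra.
have IO n : I n `<=` Omega.
  by move=> x; have := Itv n; rewrite /I/Omega/= !in_itv/=; lra.
have mI n : measurable (I n) by exact: measurable_itv.
have core n : mu.-integrable (I n) (EFin \o (gam \* phin n)) /\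
    \int[mu]_(x in I n) (gam x * phin n x) <= n.+1%:R^-1.
  have [n1 [nn n2]] := Itv n.
  have [|||||ii le_i] := integral_monotone_weight G gam (phin n) _ _ nn.
  - exact: Gl.
  - by move=> x xI; apply: Gg; lra.
  - by move=> x xI; apply: G0; lra.
  - by apply: measurable_trunc;
      exact: (measurable_funS measurable_Omega (IO n) mphi).
  - by move=> x y xI xy yI; apply: trunc_homo; apply: phi_homo => //; lra.
  split => //; apply: (le_trans le_i).
  have [_ Hs] := Hk n; apply: le_trans Hs.
  (* The boundary terms are at most [n] times the values of [G], however large [phi] is there. *)
  have bd (u : R) : - n%:R <= trunc n%:R u <= (n%:R : R).
    by rewrite -ler_norml; apply: trunc_bound.
  have g1 : 0 <= G (inner (k n)) by apply: G0; lra.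
  have g2 : 0 <= G (- inner (k n)) by apply: G0; lra.
  rewrite /phin mulrDr; have := bd (phi (inner (k n))).
  have := bd (phi (- inner (k n))); nra.
pose f n := funepos ((EFin \o (gam \* phin n)) \_ (I n)).
have mgp n (D : set R) : measurable D -> D `<=` Omega ->
  measurable_fun D (EFin \o (gam \* phin n)).
  move=> mD DO; apply/measurable_EFinP; apply: measurable_funM.
    exact: (measurable_funS measurable_Omega DO mgam).
  by apply: measurable_trunc; exact: (measurable_funS measurable_Omega DO mphi).
apply: (integral_le_of_fatou f).
- exact: measurable_Omega.
- move=> n; apply: measurable_funepos.
  apply/(measurable_restrict _ _ _).1; [exact: mI|exact: measurable_Omega|].
  apply: mgp; last exact: subIsetl.
  by apply: measurableI; [exact: measurable_Omega|exact: mI].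
- by move=> n x _; exact: funepos_ge0.
(* For fixed [x] the sequence is eventually constant: once [n] exceeds [|phi x|] and [x] lies in
   [I n], neither the truncation nor the restriction acts. *)
- move=> x; rewrite /Omega/= in_itv/= => xO; apply: cvg_near_cst; near=> n.
  have nx : `|phi x| <= n%:R.
    near: n; exact: nbhs_infty_ger.
  have xI : - inner n < x < inner n by near: n; exact: near_inner.
  rewrite /f !funeposE/= patchE mem_set/=; last first.
    have [/inner_homo nk _] := Hk n; rewrite /I/= in_itv/=.
    lra.
  by rewrite /phin trunc_id.
- move=> n; have -> : (\int[mu]_(x in Omega) f n x =
      \int[mu]_(x in I n) (EFin \o (gam \* phin n)%R)^\+ x)%E.
    by rewrite /f funepos_restrict -integral_mkcondr (setIidr (IO n)).
  have [ci cle] := core n.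
  apply: (le_trans (integral_funepos_le _ _ _ (mI n) ci cle)).
  rewrite leeD2r//.
  have mh (D : set R) : D `<=` Omega ->
      measurable_fun D (EFin \o (gam \* phi)).
    move=> DO; apply/measurable_EFinP; apply: measurable_funM.
      exact: (measurable_funS measurable_Omega DO mgam).
    exact: (measurable_funS measurable_Omega DO mphi).
  (* The integral of the negative part grows when the truncation is lifted, and again from [I n] to
     [Omega]. *)
  apply: (@le_trans _ _ (\int[mu]_(x in I n) (EFin \o (gam \* phi)%R)^\- x)%E).
    apply: ge0_le_integral => //.
    + exact: mI.
    + by apply: measurable_funeneg; apply: mgp => //; exact: IO.
    + by apply: measurable_funeneg; apply: mh; exact: IO.
    + move=> x _; rewrite !funenegE/= -!EFin_max lee_fin.
      exact: neg_part_trunc.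
  apply: ge0_subset_integral => //.
  + exact: mI.
  + exact: measurable_Omega.
  + by apply: measurable_funeneg; exact: mh.
Unshelve. all: by end_near. Qed.

(** * The energy *)

Lemma is_derive_a x : is_derive x 1 a (- (2 * x)).
Proof.
apply: (is_derive_quadratic 1) => // h; rewrite /a.
rewrite (_ : _ - _ - _ = - h ^+ 2); last by ring.
by rewrite normrN mul1r ger0_norm// sqr_ge0.
Qed.

Lemma a_gt0 x : -1 < x < 1 -> 0 < a x.
Proof. by rewrite /a => x11; nra. Qed.

Lemma loc_lip_a : loc_lip (@a R).
Proof.
move=> c d _ _; apply: lip_itv_C1 => [x|];
  first by have [dx _] := is_derive_a x; exact: dx.
rewrite (_ : derive1 _ = fun x => - (2 * x)).
  move=> x; apply: cvgN; apply: cvgM; [exact: cvg_cst|exact: cvg_id].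
by apply/funext => x; rewrite derive1E; have [_ ->] := is_derive_a x.
Qed.

Lemma loc_lip_aV : loc_lip (fun x : R => (a x)^-1).
Proof.
(* On [[c, d]], [a x = (1 + x) (1 - x)] is at least the product of the minima of its two factors. *)
move=> c d c1 d1; have e0 : 0 < (1 + c) * (1 - d) by rewrite mulr_gt0; lra.
apply: (lip_itvV _ _ _ _ e0); last exact: loc_lip_a.
by move=> x xcd; rewrite /a; nra.
Qed.

Lemma loc_lipD F G : loc_lip F -> loc_lip G -> loc_lip (F \+ G).
Proof. by move=> Fl Gl c d c1 d1; apply: lip_itvD; [exact: Fl|exact: Gl]. Qed.

Lemma loc_lipM F G : loc_lip F -> loc_lip G -> loc_lip (F \* G).
Proof. by move=> Fl Gl c d c1 d1; apply: lip_itvM; [exact: Fl|exact: Gl]. Qed.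

Lemma loc_lip_cst l : loc_lip (cst l : R -> R).
Proof. by move=> c d _ _; exists 0 => // x y _ _;
  rewrite subrr normr0 mul0r. Qed.

Lemma rderiv_cst l x : rderiv (cst l) x 0.
Proof. by apply: derivable_rderiv; exact: is_derive_cst. Qed.

Lemma rderiv_aV x : -1 < x < 1 ->
  rderiv (fun x => (a x)^-1) x (2 * x / a x ^+ 2).
Proof.
move=> /a_gt0 a0; apply: derivable_rderiv.
have := is_derive1V _ _ _ (lt0r_neq0 a0) (is_derive_a x).
by rewrite mulrNN mulrC.
Qed.

(** The quotient rule for [F^2 / a], with [phi] for [F'] and [a' = - 2 x]. *)
Definition dsqr_div_a F phi x : R :=
  2 * F x * phi x / a x + 2 * x * F x ^+ 2 / a x ^+ 2.

Lemma rderiv_sqr_div_a F phi x : -1 < x < 1 -> rderiv F x (phi x) ->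
  rderiv (fun s => F s ^+ 2 / a s) x (dsqr_div_a F phi x).
Proof.
move=> xO Fx; have H := rderivM _ _ _ _ _ (rderivM _ _ _ _ _ Fx Fx) (rderiv_aV x xO).
have -> : dsqr_div_a F phi x = (phi x * F x + F x * phi x) * (a x)^-1 +
    (F \* F) x * (2 * x / a x ^+ 2) by rewrite /dsqr_div_a/=; ring.
exact: H.
Qed.

Lemma loc_lip_sqr_div_a F : loc_lip F -> loc_lip (fun s => F s ^+ 2 / a s).
Proof. by move=> Fl; exact: (loc_lipM _ _ (loc_lipM _ _ Fl Fl) loc_lip_aV). Qed.

(** Once a weak derivative exists, [xget] returns one, and uniqueness identifies it with [g] off a
    null set. *)
Lemma weak_deriv_ae F g : is_weak_derivative F g ->
  locally_integrable Omega (weak_deriv F) /\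
  {ae mu, forall x, -1 < x < 1 -> weak_deriv F x = g x}.
Proof.
move=> Fg; have Fw : is_weak_derivative F (weak_deriv F).
  by apply: (@xgetPex _ (fun=> 0) [set g | is_weak_derivative F g]); exists g.
by split; [case: Fw|exact: (weak_derivative_unique F)].
Qed.

Lemma weak_derivative_measurable F g : is_weak_derivative F g ->
  measurable_fun Omega g.
Proof. by case=> _ []. Qed.

(** Trades the choice hidden in [weak_deriv] for explicit pointwise derivatives, both of [F] and of
    [F^2 / a]. *)
Lemma J_rderiv F phi : loc_lip F ->
  (forall x, -1 < x < 1 -> rderiv F x (phi x)) ->
  (J F = \int[mu]_(x in Omega)
    (dsqr_div_a F phi x * phi x + 2^-1 * phi x ^+ 2)%:E)%E.
Proof.
move=> Fl Fphi; have wF := rderiv_weak_derivative _ _ Fl Fphi.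
have wW := rderiv_weak_derivative _ _ (loc_lip_sqr_div_a _ Fl)
  (fun x xO => rderiv_sqr_div_a F phi x xO (Fphi x xO)).
have [[mF _ _] eF] := weak_deriv_ae _ _ wF.
have [[mW _ _] eW] := weak_deriv_ae _ _ wW.
have mphi := weak_derivative_measurable _ _ wF.
have mkap := weak_derivative_measurable _ _ wW.
rewrite /J; apply: ae_eq_integral.
- exact: measurable_Omega.
- apply/measurable_EFinP; apply: measurable_funD; first exact: measurable_funM.
  apply: measurable_funM; first exact: measurable_cst.
  exact: measurable_funX.
- apply/measurable_EFinP; apply: measurable_funD; first exact: measurable_funM.
  apply: measurable_funM; first exact: measurable_cst.
  exact: measurable_funX.
- have eFW : {ae mu, forall x, (-1 < x < 1 -> weak_deriv F x = phi x) /\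
    (-1 < x < 1 -> weak_deriv (fun s => F s ^+ 2 / a s) x = dsqr_div_a F phi x)}.
    by apply: filterS2 eF eW; first exact: (ae_filter_ringOfSetsType mu).
  apply: ae_impl eFW => x [e1 e2]; rewrite /Omega/= in_itv/= => xO.
  by rewrite e1// e2.
Qed.

Lemma measurable_scale l (D : set R) : measurable_fun D (fun x => l * x).
Proof.
apply: continuous_measurable_itv => x.
by apply: cvgM; [exact: cvg_cst|exact: cvg_id].
Qed.

Lemma max_opp_add_norm (u v : R) :
  Num.max (- u) 0 <= Num.max (- (u + v)) 0 + `|v|.
Proof.
have v0 := normr_ge0 v; have vN := ler_norm v.
by case: (leP (- u) 0) => ?; case: (leP (- (u + v)) 0) => ?; lra.
Qed.

Lemma integral_add_pos_le_neg h q : measurable_fun Omega h ->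
  mu.-integrable Omega (EFin \o q) ->
  (\int[mu]_(x in Omega) (EFin \o h)^\+ x <=
   \int[mu]_(x in Omega) (EFin \o h)^\- x)%E ->
  (\int[mu]_(x in Omega) (h x + q x)%:E <= \int[mu]_(x in Omega) (q x)%:E)%E.
Proof.
move=> mh iq hpn.
have mO := measurable_Omega.
have mEh : measurable_fun Omega (EFin \o h) by exact/measurable_EFinP.
have [hfin|] := ltP (\int[mu]_(x in Omega) (EFin \o h)^\- x)%E +oo%E.
  have ih : mu.-integrable Omega (EFin \o h).
    apply/integrableP; split => //.
    have -> : (\int[mu]_(x in Omega) `|(EFin \o h) x| =
        \int[mu]_(x in Omega) ((EFin \o h)^\+ x + (EFin \o h)^\- x))%E.
      by apply: eq_integral => x _;
        rewrite -[LHS]/((abse \o (EFin \o h)) x) fune_abse.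
    rewrite ge0_integralD//; last 2 first.
    - exact: measurable_funepos.
    - exact: measurable_funeneg.
    by rewrite lte_add_pinfty// (le_lt_trans hpn).
  have -> : (\int[mu]_(x in Omega) (h x + q x)%:E =
    \int[mu]_(x in Omega) (h x)%:E + \int[mu]_(x in Omega) (q x)%:E)%E.
    exact: integralD_EFin.
  rewrite -[leRHS]add0e leeD2r//.
  have -> : (\int[mu]_(x in Omega) (h x)%:E = \int[mu]_(x in Omega) (EFin \o h)^\+ x -
      \int[mu]_(x in Omega) (EFin \o h)^\- x)%E by exact: integralE.
  by rewrite sube_le0.
rewrite leye_eq => /eqP hoo.
have mq : measurable_fun Omega q by apply/measurable_EFinP;
  exact: measurable_int iq.
have mhq : measurable_fun Omega (EFin \o (h \+ q)).
  by apply/measurable_EFinP; exact: measurable_funD.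
(* If [h] is not integrable, the integral of [h + q] is [-oo], whether or not
   its positive part is integrable, since [+oo - +oo = -oo]. *)
have fneg : (\int[mu]_(x in Omega) (EFin \o (h \+ q)%R)^\- x = +oo)%E.
  have [fin|] := ltP (\int[mu]_(x in Omega) (EFin \o (h \+ q)%R)^\- x)%E +oo%E;
    last by rewrite leye_eq => /eqP.
  suff : (\int[mu]_(x in Omega) (EFin \o h)^\- x < +oo)%E by rewrite hoo ltxx.
  apply: (@le_lt_trans _ _ (\int[mu]_(x in Omega)
      ((EFin \o (h \+ q)%R)^\- x + `|(EFin \o q) x|))%E).
    apply: ge0_le_integral => //.
    - exact: measurable_funeneg.
    - apply: emeasurable_funD; first exact: measurable_funeneg.
      by apply: measurableT_comp => //; exact/measurable_EFinP.
    - move=> x _; rewrite !funenegE/= -!EFin_max -EFinD lee_fin.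
      exact: max_opp_add_norm.
  rewrite ge0_integralD//; last 2 first.
  - exact: measurable_funeneg.
  - by apply: measurableT_comp => //; exact/measurable_EFinP.
  by rewrite lte_add_pinfty//; case/integrableP : iq.
have -> : (\int[mu]_(x in Omega) (h x + q x)%:E =
    \int[mu]_(x in Omega) (EFin \o (h \+ q)%R)^\+ x -
    \int[mu]_(x in Omega) (EFin \o (h \+ q)%R)^\- x)%E by exact: integralE.
rewrite fneg.
by rewrite addeNy leNye.
Qed.

Lemma integrable_sqr_shift phi : measurable_fun Omega phi ->
  mu.-integrable Omega (EFin \o (fun x => phi x ^+ 2)) ->
  mu.-integrable Omega (EFin \o (fun x => (phi x - 2 / 3 * x) ^+ 2)).
Proof.
move=> mphi i2.
have mO := measurable_Omega.
have ic : mu.-integrable Omega (EFin \o (fun _ : R => 1)).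
  by apply: (bounded_integrable_itv _ 1) => // x _; rewrite normr1.
(* A majorant: [(u - v)^2 <= 2 u^2 + 2 v^2], and [2 (2 x / 3)^2 <= 1] on [Omega]. *)
have ig : mu.-integrable Omega (EFin \o (fun x => 2 * phi x ^+ 2 + 1)).
  by apply: eq_integrable (integrableD _ (integrableZl _ 2 i2) ic).
apply: (@le_integrable _ _ _ mu Omega mO _ (EFin \o (fun x => 2 * phi x ^+ 2 + 1))).
- apply/measurable_EFinP; apply: measurable_funX.
  exact: (measurable_funB mphi (measurable_scale _ _)).
- move=> x; rewrite /Omega/= in_itv/= => xO; rewrite lee_fin !ger0_norm.
  + by have := sqr_ge0 (phi x + 2 / 3 * x); nra.
  + by rewrite addr_ge0// mulr_ge0// sqr_ge0.
  + exact: sqr_ge0.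
- exact: ig.
Qed.

(** This is the density of [J] at [- a / 3]: there [(F^2 / a)' F' = - 4 x^2 / 27] and
    [F'^2 / 2 = 6 x^2 / 27]. *)
Lemma integrable_max_density :
  mu.-integrable Omega (EFin \o (fun x => 2 / 27 * x ^+ 2)).
Proof.
apply: (bounded_integrable_itv _ (2 / 27)).
  apply: continuous_measurable_itv => x; apply: cvgM; first exact: cvg_cst.
  by apply: cvgM; exact: cvg_id.
by move=> x xO; rewrite ler_norml; apply/andP; split; nra.
Qed.

Lemma J_upper_bound F : calF F -> sobolevH1 F ->
  mu.-integrable Omega (EFin \o (fun x => (rder F x - 2 / 3 * x) ^+ 2)) /\
  (J F + (6^-1 * \int[mu]_(x in Omega) ((rder F x - 2 / 3 * x) ^+ 2))%:E <=
   \int[mu]_(x in Omega) (2 / 27 * x ^+ 2)%:E)%E.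
Proof.
move=> [Fm1 F1 /convex_function3 cF] [contF [g Fg ig]].
have Fl := convex3_loc_lip _ cF.
pose phi := rder F.
have Fphi x : -1 < x < 1 -> rderiv F x (phi x) by exact: convex3_rderiv.
have wF := rderiv_weak_derivative _ _ Fl Fphi.
have mphi := weak_derivative_measurable _ _ wF.
have mg := weak_derivative_measurable _ _ Fg.
have mO := measurable_Omega.
(* Square integrability is given for the weak derivative [g]; uniqueness passes it on to the right
   derivative. *)
have i2 : mu.-integrable Omega (EFin \o (fun x => phi x ^+ 2)).
  apply/integrableP; split; first by apply/measurable_EFinP;
    exact: measurable_funX.
  apply: le_lt_trans ig; rewrite le_eqVlt; apply/orP; left; apply/eqP.
  apply: ae_eq_integral => //.
  - by apply/measurable_EFinP; apply: measurableT_comp => //;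
      exact: measurable_funX.
  - by apply/measurable_EFinP; exact: measurable_funX.
  - apply: ae_impl (weak_derivative_unique _ _ _ wF Fg) => x e1.
    by rewrite /Omega/= in_itv/= => xO; rewrite e1// ger0_norm ?sqr_ge0.
have ish := integrable_sqr_shift _ mphi i2.
split => //.
pose kap := dsqr_div_a F phi.
have wW := rderiv_weak_derivative _ _ (loc_lip_sqr_div_a _ Fl)
  (fun x xO => rderiv_sqr_div_a F phi x xO (Fphi x xO)).
have mkap := weak_derivative_measurable _ _ wW.
pose W s := F s ^+ 2 / a s.
(* The expanded form lets the sum rule produce [gam], and each term has its own limit 0 at the
   ends. *)
pose G := (W \+ (cst (2 / 3) \* F)) \+ (cst (1 / 9) \* a).
pose gam x := kap x + 2 / 3 * phi x - 2 / 9 * x.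
have Gl : loc_lip G.
  apply: loc_lipD; first apply: loc_lipD.
  - exact: loc_lip_sqr_div_a.
  - by apply: loc_lipM => //; exact: loc_lip_cst.
  - by apply: loc_lipM; [exact: loc_lip_cst|exact: loc_lip_a].
have Gg x : -1 < x < 1 -> rderiv G x (gam x).
  move=> xO.
  have r1 := rderiv_sqr_div_a F phi x xO (Fphi x xO).
  have r2 := rderivM _ _ _ _ _ (rderiv_cst (2 / 3) x) (Fphi x xO).
  have r3 := rderivM _ _ _ _ _ (rderiv_cst (1 / 9) x)
    (derivable_rderiv _ _ _ (is_derive_a x)).
  have := rderivD _ _ _ _ _ (rderivD _ _ _ _ _ r1 r2) r3.
  rewrite /G /gam (_ : _ + _ + _ = kap x + 2 / 3 * phi x - 2 / 9 * x)//=.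
  by rewrite !mul0r !add0r /kap; lra.
have G0 x : -1 < x < 1 -> 0 <= G x.
  move=> /a_gt0 a0; rewrite /G/= /W.
  rewrite (_ : _ + _ = (F x + a x / 3) ^+ 2 / a x); last by field;
    rewrite gt_eqF.
  by rewrite divr_ge0 ?sqr_ge0// ltW.
have mgam : measurable_fun Omega gam.
  apply: measurable_funB; last exact: measurable_scale.
  apply: measurable_funD; first exact: mkap.
  by apply: measurable_funM; [exact: measurable_cst|exact: mphi].
have ca s : `|s| = 1 -> a (s * inner n) @[n --> \oo] --> (0 : R).
  move=> s1; have s2 : s ^+ 2 = 1 by rewrite -real_normK ?num_real// s1 expr1n.
  rewrite (_ : (fun n => a (s * inner n)) = fun n => 1 - inner n * inner n).
    have c1 := cvg_inner.
    rewrite -[X in _ --> X](subrr (1 * 1 : R)) [X in X - _]mulr1.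
    by apply: cvgB; [exact: cvg_cst|exact: cvgM].
  by apply/funext => n; rewrite /a exprMn s2 mul1r.
have Gs s : `|s| = 1 -> F (s * inner n) @[n --> \oo] --> (0 : R) ->
    G (s * inner n) @[n --> \oo] --> (0 : R).
  move=> s1 cFs; rewrite (_ : 0 = 0 + 2 / 3 * 0 + 1 / 9 * 0); last by ring.
  apply: cvgD; first apply: cvgD.
  - exact: (cvg_boundary F phi).
  - by apply: cvgM; [exact: cvg_cst|exact: cFs].
  - by apply: cvgM; [exact: cvg_cst|exact: ca].
have Gr : G (inner n) @[n --> \oo] --> (0 : R).
  rewrite (_ : (fun n => G (inner n)) = fun n => G (1 * inner n)); last first.
    by apply/funext => n; rewrite mul1r.
  apply: Gs; first exact: normr1.
  rewrite (_ : (fun n => F (1 * inner n)) = fun n => F (inner n)); last first.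
    by apply/funext => n; rewrite mul1r.
  exact: (cvg_F_right F).
have Gr' : G (- inner n) @[n --> \oo] --> (0 : R).
  rewrite (_ : (fun n => G (- inner n)) = fun n => G (-1 * inner n));
    last first.
    by apply/funext => n; rewrite mulN1r.
  apply: Gs; first exact: normrN1.
  rewrite (_ : (fun n => F (-1 * inner n)) = fun n => F (- inner n));
    last first.
    by apply/funext => n; rewrite mulN1r.
  exact: (cvg_F_left F).
have key := integral_weight_pos_le_neg G gam phi Gl Gg G0 Gr Gr' mgam mphi
  (fun x y (p : -1 < x) (q : x <= y) (r : y < 1) => rder_homo F x y cF p q r).
(* What remains of the integrand of [J] besides [gam \* phi]; this part is integrable even if the
   product is not. *)
pose q x := 2 / 27 * x ^+ 2 - 6^-1 * (phi x - 2 / 3 * x) ^+ 2.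
have i27 := integrable_max_density.
have i6 : mu.-integrable Omega (EFin \o (fun x => 6^-1 * (phi x - 2 / 3 * x) ^+ 2)).
  by apply: eq_integrable (integrableZl _ (6^-1) ish).
have iq : mu.-integrable Omega (EFin \o q).
  by apply: eq_integrable (integrableB _ i27 i6).
have mh : measurable_fun Omega (gam \* phi) by exact: measurable_funM.
have := integral_add_pos_le_neg _ _ mh iq key.
rewrite (J_rderiv F phi Fl Fphi).
have -> : (\int[mu]_(x in Omega) ((gam \* phi)%R x + q x)%:E =
  \int[mu]_(x in Omega) (dsqr_div_a F phi x * phi x + 2^-1 * phi x ^+ 2)%:E)%E.
  apply: eq_integral => x _; congr EFin.
  by rewrite /= /gam /q /kap; field.
have -> : (\int[mu]_(x in Omega) (q x)%:E = \int[mu]_(x in Omega) (2 / 27 * x ^+ 2)%:E -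
    \int[mu]_(x in Omega) (6^-1 * (phi x - 2 / 3 * x) ^+ 2)%:E)%E.
  exact: integralB_EFin.
have -> : (\int[mu]_(x in Omega) (6^-1 * (phi x - 2 / 3 * x) ^+ 2)%:E =
    (6^-1 * \int[mu]_(x in Omega) ((phi x - 2 / 3 * x) ^+ 2))%:E)%E.
  rewrite -RintegralZl//; apply/esym/fineK; exact: integrable_fin_num.
by rewrite leeBrDr.
Qed.

(** * The candidate [- a / 3] and the case of equality *)

Definition eq_maximizer F := {in `[-1, 1], forall r, F r = - (1 / 3) * a r}.

Lemma eq_maximizer_loc_lip F : eq_maximizer F -> loc_lip F.
Proof.
move=> FE c d c1 d1.
have [L L0 HL] := loc_lipM _ _ (loc_lip_cst (- (1 / 3))) loc_lip_a c d c1 d1.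
exists L => // x y xI yI; rewrite !FE ?in_itv/=; [exact: HL|lra|lra].
Qed.

Lemma eq_maximizer_rderiv F x : eq_maximizer F -> -1 < x < 1 ->
  rderiv F x (2 / 3 * x).
Proof.
move=> FE xO.
have r := rderivM _ _ _ _ _ (rderiv_cst (- (1 / 3)) x)
    (derivable_rderiv _ _ _ (is_derive_a x)).
apply: (rderiv_near (cst (- (1 / 3)) \* a) _ _ 1); [lra| |].
  by move=> y y1; rewrite FE// in_itv/=; lra.
rewrite (_ : 2 / 3 * x = 0 * a x + cst (- (1 / 3)) x * - (2 * x));
  first exact: r.
by rewrite /=; lra.
Qed.

Lemma eq_maximizer_calF F : eq_maximizer F -> calF F.
Proof.
move=> FE; split.
- by rewrite FE ?in_itv/= ?lexx ?andbT; [rewrite /a; lra|lra].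
- by rewrite FE ?in_itv/= ?lexx; [rewrite /a; lra|lra].
move=> t x y; rewrite !inE/= !in_itv/= => xI yI.
set s : R := t%:num.
have s0 : 0 <= s by rewrite /s ge0.
have s1 : s <= 1 by rewrite /s le1.
have : F (s * x + (1 - s) * y) <= s * F x + (1 - s) * F y.
  rewrite !FE ?in_itv//=; last by nra.
  (* The convexity defect of [F] is one third of this quantity. *)
  rewrite /a; have : 0 <= s * (1 - s) * (x - y) ^+ 2.
    by rewrite mulr_ge0 ?sqr_ge0// mulr_ge0//; lra.
  nra.
exact.
Qed.

Lemma eq_maximizer_sobolevH1 F : eq_maximizer F -> sobolevH1 F.
Proof.
move=> FE; split.
  apply: (@subspace_eq_continuous _ _ _ (fun x => - (1 / 3) * a x)).
    by move=> x; rewrite inE => xI; exact/esym/FE.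
  apply: continuous_subspaceT => x; apply: cvgM; first exact: cvg_cst.
  have [dx _] := is_derive_a x.
  exact/differentiable_continuous/derivable1_diffP.
exists (fun x => 2 / 3 * x).
  apply: rderiv_weak_derivative; first exact: eq_maximizer_loc_lip.
  by move=> x; exact: eq_maximizer_rderiv.
have : mu.-integrable Omega (EFin \o (fun x => (2 / 3 * x) ^+ 2)).
  apply: (bounded_integrable_itv _ 1).
    by apply: measurable_funX; exact: measurable_scale.
  by move=> x xO; rewrite ler_norml; apply/andP; split; nra.
case/integrableP => _; apply: le_lt_trans; rewrite le_eqVlt; apply/orP; left.
by apply/eqP; apply: eq_integral => x _ /=; rewrite ger0_norm ?sqr_ge0.
Qed.

Lemma integral_max_density_fin_num :
  (\int[mu]_(x in Omega) (2 / 27 * x ^+ 2)%:E)%E \is a fin_num.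
Proof.
apply: integrable_fin_num; first exact: measurable_Omega.
exact: integrable_max_density.
Qed.

Lemma eq_maximizer_J F : eq_maximizer F ->
  (J F = \int[mu]_(x in Omega) (2 / 27 * x ^+ 2)%:E)%E.
Proof.
move=> FE; rewrite (J_rderiv F (fun x => 2 / 3 * x)).
- apply: eq_integral => x; rewrite inE /Omega/= in_itv/= => xO; congr EFin.
  have a0 := a_gt0 _ xO.
  by rewrite /dsqr_div_a FE ?in_itv/=; [field; rewrite gt_eqF|lra].
- exact: eq_maximizer_loc_lip.
- by move=> x; exact: eq_maximizer_rderiv.
Qed.

(** [D = F + a / 3] has right derivative [phi] and vanishes at 1, so [sqr_le_right] applied to [D]
    bounds [D r ^+ 2] by a multiple of [\int phi^2]. The equality thus holds at every point, not
    just almost everywhere. *)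
Lemma zero_energy_gap_eq_maximizer F : calF F -> sobolevH1 F ->
  mu.-integrable Omega (EFin \o (fun x => (rder F x - 2 / 3 * x) ^+ 2)) ->
  \int[mu]_(x in Omega) ((rder F x - 2 / 3 * x) ^+ 2) <= 0 ->
  eq_maximizer F.
Proof.
move=> [Fm1 F1 /convex_function3 cF] [contF _] ish I0.
pose D := F \+ (cst (1 / 3) \* a).
pose phi x := rder F x - 2 / 3 * x.
have Dl : loc_lip D.
  apply: loc_lipD; first exact: convex3_loc_lip.
  by apply: loc_lipM; [exact: loc_lip_cst|exact: loc_lip_a].
have Dphi x : -1 < x < 1 -> rderiv D x (phi x).
  move=> xO; have r1 := convex3_rderiv _ _ cF xO.
  have r2 := rderivM _ _ _ _ _ (rderiv_cst (1 / 3) x)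
    (derivable_rderiv _ _ _ (is_derive_a x)).
  have := rderivD _ _ _ _ _ r1 r2.
  rewrite (_ : _ + _ = phi x)//; rewrite /phi/=; lra.
have contD : {within `[-1, 1], continuous D}.
  have ca : continuous (cst (1 / 3) \* (a : R -> R)).
    move=> x; apply: cvgM; first exact: cvg_cst.
    have [dx _] := is_derive_a x.
    exact/differentiable_continuous/derivable1_diffP.
  move=> x; apply: cvgD; first exact: contF.
  exact: continuous_subspaceT.
have D1 : D 1 = 0 by rewrite /D/= F1 /a; lra.
have Dm1 : D (-1) = 0 by rewrite /D/= Fm1 /a; lra.
move=> r; rewrite in_itv/= => rI.
suff : D r = 0 by rewrite /D/=; lra.
have [->//|r1] := eqVneq r 1; have [->//|rm1] := eqVneq r (-1).
have rO : -1 < r < 1 by move: r1 rm1; rewrite !lt_neqAle [_ == r]eq_sym; lra.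
have := sqr_le_right D phi Dl Dphi contD D1 ish r rO.
have I1 : \int[mu]_(t in `]r, 1[) (phi t ^+ 2) <= 0.
  apply: le_trans I0; apply: Rintegral_subset => //.
  - exact: measurable_Omega.
  - by move=> t; rewrite /Omega/= !in_itv/=; lra.
  - by move=> t _; exact: sqr_ge0.
move=> Dr; apply/eqP; rewrite -sqrf_eq0 eq_le sqr_ge0 andbT.
by apply: (le_trans Dr); rewrite mulr_ge0_le0//; lra.
Qed.

End weak_derivatives.

Theorem theorem1p1 (R : realType) :
  argmax (calF `&` sobolevH1) (@J R) =
  [set F : R -> R | {in `[-1, 1], forall r, F r = - (1 / 3) * a r}].
Proof.
apply/seteqP; split => [F [[FF FH] Fmax]|F FE] /=.
  have [ish le_J] := J_upper_bound F FF FH.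
  apply: (zero_energy_gap_eq_maximizer F FF FH ish).
  pose F0 : R -> R := fun r => - (1 / 3) * a r.
  have F0E : eq_maximizer F0 by [].
  have := Fmax F0 (conj (eq_maximizer_calF _ F0E) (eq_maximizer_sobolevH1 _ F0E)).
  rewrite (eq_maximizer_J _ F0E) => le_F0.
  have ifin := @integral_max_density_fin_num R.
  (* Maximality gives [J F0 <= J F]. Adding the gap and comparing with [J_upper_bound] leaves a gap
     [<= 0], since [J F0] is finite and cancels. *)
  have := le_trans (leeD2r _ le_F0) le_J.
  rewrite -[leRHS]adde0 leeD2lE// lee_fin pmulr_rle0//; exact.
split; first by split; [exact: eq_maximizer_calF|exact: eq_maximizer_sobolevH1].
move=> G [GF GH]; rewrite (eq_maximizer_J _ FE).
(* The nonnegative gap is dropped; this is valid also when [J G] is [-oo]. *)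
have [_] := J_upper_bound G GF GH; apply: le_trans.
rewrite leeDl// lee_fin mulr_ge0//.
by apply: Rintegral_ge0 => t _; exact: sqr_ge0.
Qed.
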